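(* Let $(\beta,\theta_c)\in(\frac\pi2,\pi)\times(0,\pi]$ and $(A,\sigma)\in\Omega_0$, and let $\bar r,\lambda,a_\ell$ be real numbers with $A\le\bar r$, $\lambda\ne0$, $a_\ell\ge0$. Then the explicit family $\mathcal F(A,\bar r,\lambda,a_\ell;\beta,\theta_c)$ constitutes a steady state for $(\beta,\theta_c)$ whose curve $\Gamma_3$ has arclength $\sigma$ if and only if both (P) and (N) hold: (P) $\bar r=\sqrt{\sigma^2+A^2}$, $0<\bar r<1$; $\bar z=A\,\mathrm{arccosh}\big(\tfrac{\sqrt{\sigma^2+A^2}}{A}\big)>0$; $\bar\theta_3=\arcsin\big(\tfrac{A}{\sqrt{\sigma^2+A^2}}\big)$, $\bar\theta_1=\bar\theta_3-\beta$, $\bar\theta_2=\bar\theta_3+\beta-\pi$, with $0<\bar\theta_3<\frac\pi2$, $-\pi<\bar\theta_1<0$, $0<\bar\theta_2<\bar\theta_3$; $\lambda=\frac{A\cos\beta+\sigma\sin\beta}{1-A^2-\sigma^2}$, $\lambda<0$; and $a_\ell=\sqrt{\frac{(2A^2+2\sigma^2-1)A\cos\beta+\sigma\sin\beta}{A\cos\beta+\sigma\sin\beta}}$, $0<a_\ell<1$. (N) $\tan\beta>\frac A\sigma(1-2A^2-2\sigma^2)$; $\ \cos\beta<-\frac1{2A}$ if $\cos\beta<-\frac{A}{\sqrt{\sigma^2+A^2}}$; $\ z_1(\theta_c)=0$; and $\Gamma_1\cap\Gamma_3=\{(\bar r,\bar z)\}$.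
   Context: $\Omega_0=\{(A,\sigma):0<A<1,\ 0<\sigma<\sqrt{1-A^2}\}$. **Steady states.** Fix $\beta\in[\pi/2,\pi)$ and $\theta_c\in[0,\pi]$. A steady state for $(\beta,\theta_c)$ consists of three curves $\Gamma_i=\{(r_i(\alpha),z_i(\alpha)):\alpha\in[0,1]\}$, $i=1,2,3$, with $r_i,z_i\in C^2([0,1])$ (subscript $\alpha$ denotes $d/d\alpha$), such that: (a) $0<r_1,r_3<1$ on $[0,1]$; $0<r_2<1$ on $[0,1)$; $z_1,z_3>0$ on $(0,1]$; $z_2>0$ on $[0,1]$. (b) There are numbers $0<r_1^*<r_3^*<1$, $z_2^*>0$, $\bar r\in(0,1)$, $\bar z>0$ with $(r_1,z_1)(0)=(r_1^*,0)$, $(r_1,z_1)(1)=(\bar r,\bar z)$, $(r_2,z_2)(0)=(\bar r,\bar z)$, $(r_2,z_2)(1)=(1,z_2^* )$, $(r_3,z_3)(0)=(r_3^*,0)$, $(r_3,z_3)(1)=(\bar r,\bar z)$. (c) For each $i$, $r_{i\alpha}^2+z_{i\alpha}^2$ is a positive constant. (d) With $H_i=\frac{r_{i\alpha}z_{i\alpha\alpha}-z_{i\alpha}r_{i\alpha\alpha}}{2(r_{i\alpha}^2+z_{i\alpha}^2)^{3/2}}+\frac{z_{i\alpha}}{2r_i\sqrt{r_{i\alpha}^2+z_{i\alpha}^2}}$, there is a real constant such that $H_1$ and $H_2$ are both identically equal to it, and $H_3\equiv0$ on $[0,1]$. (e) There are continuous $\theta_i:[0,1]\to(-\pi,\pi]$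 with $(\cos\theta_i,\sin\theta_i)=(r_{i\alpha},z_{i\alpha})/\sqrt{r_{i\alpha}^2+z_{i\alpha}^2}$, and $\theta_1(0)=\theta_c$, $\theta_2(1)=0$, $\theta_3(0)=\pi/2$, $-\theta_1(1)+\theta_3(1)=\beta$, $\theta_2(0)-\theta_3(1)=-\pi+\beta$. (f) No $\Gamma_i$ self-intersects, and any two distinct curves $\Gamma_i,\Gamma_j$ intersect only at $(\bar r,\bar z)$. **The explicit family $\mathcal F(A,\bar r,\lambda,a_\ell;\beta,\theta_c)$.** Set $\bar\theta_3=\arcsin(A/\bar r)$, $\bar\theta_1=\bar\theta_3-\beta$, $\bar\theta_2=\bar\theta_3-\pi+\beta$, $\bar z=A\,\mathrm{arccosh}(\bar r/A)$ (with $\mathrm{arccosh}:[1,\infty)\to[0,\infty)$, $\arcsin:[-1,1]\to[-\pi/2,\pi/2]$), and $\Gamma_1$: $r_1(\theta_1)=\frac{\sin\theta_1-\sqrt{\sin^2\theta_1+4\lambda^2a_\ell^2}}{2\lambda}$, $z_1(\theta_1)=\bar z-\frac1{2\lambda}\int_{\bar\theta_1}^{\theta_1}\Big(\frac{\sin^2x}{\sqrt{\sin^2x+4\lambda^2a_\ell^2}}-\sin x\Big)dx$, $\theta_1\in[\bar\theta_1,\theta_c]$; $\Gamma_2$: $r_2(\theta_2)=\frac{\sin\theta_2-\sqrt{\sin^2\theta_2+4\lambda^2}}{2\lambda}$, $z_2(\theta_2)=\bar z-\frac1{2\lambda}\int_{\bar\theta_2}^{\theta_2}\Big(\frac{\sin^2x}{\sqrt{\sin^2x+4\lambda^2}}-\sin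 x\Big)dx$, $\theta_2\in[0,\bar\theta_2]$; $\Gamma_3$: $r_3(\theta_3)=\frac{A}{\sin\theta_3}$, $z_3(\theta_3)=A\log\Big(\frac{1+\cos\theta_3}{\sin\theta_3}\Big)$, $\theta_3\in[\bar\theta_3,\frac\pi2]$. The family ''constitutes a steady state for $(\beta,\theta_c)$'' if $-\pi<\bar\theta_1<0<\bar\theta_2<\bar\theta_3<\frac\pi2$ and the three curves, reparametrized by $\alpha\in[0,1]$ proportionally to arclength with $\theta_i$ decreasing in $\alpha$ (so $\alpha=0$ corresponds to $\theta_1=\theta_c$, $\theta_2=\bar\theta_2$, $\theta_3=\pi/2$), form a steady state for $(\beta,\theta_c)$. *)

(* Defs.v *)
From Stdlib Require Export Reals.
From Coquelicot Require Export Coquelicot.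
From Stdlib Require Import Lra.
Open Scope R_scope.

Definition arccosh (x : R) : R := ln (x + sqrt (x ^ 2 - 1)).

Lemma arccosh_spec (x : R) :
  1 <= x -> 0 <= arccosh x /\ cosh (arccosh x) = x.
Proof.
intros Hx.
assert (Hs : 0 <= sqrt (x ^ 2 - 1)) by apply sqrt_pos.
assert (Hq : sqrt (x ^ 2 - 1) * sqrt (x ^ 2 - 1) = x ^ 2 - 1)
  by (apply sqrt_sqrt; nra).
unfold arccosh; set (s := sqrt (x ^ 2 - 1)) in *.
split.
- rewrite <- ln_1; apply Rcomplements.ln_le; lra.
- unfold cosh; rewrite exp_Ropp, exp_ln by lra.
  assert (E : / (x + s) = x - s).
  { apply Rmult_eq_reg_l with (x + s); [|lra].
    rewrite Rinv_r by lra; nra. }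
  rewrite E; lra.
Qed.

Definition Omega0 (A sigma : R) : Prop :=
  0 < A < 1 /\ 0 < sigma < sqrt (1 - A ^ 2).

Definition arclength (r z : R -> R) (a b : R) : R :=
  RInt (fun t => sqrt (Derive r t ^ 2 + Derive z t ^ 2)) a b.

Definition trace (r z : R -> R) (a b : R) (p : R * R) : Prop :=
  exists t, a <= t <= b /\ p = (r t, z t).

Definition unit_itv (t : R) : Prop := 0 <= t <= 1.

(* [f] is C^2 on the closed interval [0,1] (derivatives one-sided at the
   endpoints), with first and second derivatives [f1] and [f2]; values outside
   [0,1] play no role. *)
Definition C2_unit (f f1 f2 : R -> R) : Prop :=
  forall t, unit_itv t ->
    D_in f f1 unit_itv t /\ D_in f1 f2 unit_itv t /\ continue_in f2 unit_itv t.

Record C2curve : Type := mkC2curve {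
  cr : R -> R; cr1 : R -> R; cr2 : R -> R;
  cz : R -> R; cz1 : R -> R; cz2 : R -> R;
  cr_C2 : C2_unit cr cr1 cr2;
  cz_C2 : C2_unit cz cz1 cz2
}.

Definition pt (G : C2curve) (t : R) : R * R := (cr G t, cz G t).

Definition speed2 (G : C2curve) (t : R) : R := cr1 G t ^ 2 + cz1 G t ^ 2.

Definition constant_speed (G : C2curve) : Prop :=
  exists c, 0 < c /\ forall t, unit_itv t -> speed2 G t = c.

(* Mean curvature of the surface generated by rotating the curve about r = 0. *)
Definition mean_curv (G : C2curve) (t : R) : R :=
  (cr1 G t * cz2 G t - cz1 G t * cr2 G t) / (2 * Rpower (speed2 G t) (3 / 2))
  + cz1 G t / (2 * cr G t * sqrt (speed2 G t)).

Definition tangent_angle (G : C2curve) (theta : R -> R) : Prop :=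
  forall t, unit_itv t ->
    continue_in theta unit_itv t /\
    - PI < theta t <= PI /\
    cos (theta t) = cr1 G t / sqrt (speed2 G t) /\
    sin (theta t) = cz1 G t / sqrt (speed2 G t).

Definition simple (G : C2curve) : Prop :=
  forall s t, unit_itv s -> unit_itv t -> pt G s = pt G t -> s = t.

Definition meet_only_at (G G' : C2curve) (p : R * R) : Prop :=
  forall s t, unit_itv s -> unit_itv t -> pt G s = pt G' t -> pt G s = p.

Definition steady_state (beta thc : R) (G1 G2 G3 : C2curve) : Prop :=
  PI / 2 <= beta < PI /\ 0 <= thc <= PI /\
  (forall t, 0 <= t <= 1 -> 0 < cr G1 t < 1 /\ 0 < cr G3 t < 1) /\
  (forall t, 0 <= t < 1 -> 0 < cr G2 t < 1) /\
  (forall t, 0 < t <= 1 -> 0 < cz G1 t /\ 0 < cz G3 t) /\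
  (forall t, 0 <= t <= 1 -> 0 < cz G2 t) /\
  (exists r1s r3s z2s rb zb : R,
     0 < r1s /\ r1s < r3s /\ r3s < 1 /\ 0 < z2s /\ 0 < rb < 1 /\ 0 < zb /\
     pt G1 0 = (r1s, 0) /\ pt G1 1 = (rb, zb) /\
     pt G2 0 = (rb, zb) /\ pt G2 1 = (1, z2s) /\
     pt G3 0 = (r3s, 0) /\ pt G3 1 = (rb, zb) /\
     simple G1 /\ simple G2 /\ simple G3 /\
     meet_only_at G1 G2 (rb, zb) /\
     meet_only_at G1 G3 (rb, zb) /\
     meet_only_at G2 G3 (rb, zb)) /\
  constant_speed G1 /\ constant_speed G2 /\ constant_speed G3 /\
  (exists H : R, forall t, unit_itv t ->
     mean_curv G1 t = H /\ mean_curv G2 t = H /\ mean_curv G3 t = 0) /\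
  (exists th1 th2 th3 : R -> R,
     tangent_angle G1 th1 /\ tangent_angle G2 th2 /\ tangent_angle G3 th3 /\
     th1 0 = thc /\ th2 1 = 0 /\ th3 0 = PI / 2 /\
     - th1 1 + th3 1 = beta /\ th2 0 - th3 1 = - PI + beta).

Definition thbar3 (A rb : R) : R := asin (A / rb).
Definition thbar1 (A rb beta : R) : R := thbar3 A rb - beta.
Definition thbar2 (A rb beta : R) : R := thbar3 A rb - PI + beta.
Definition zbar (A rb : R) : R := A * arccosh (rb / A).

Definition fr1 (lam al : R) (th : R) : R :=
  (sin th - sqrt (sin th ^ 2 + 4 * lam ^ 2 * al ^ 2)) / (2 * lam).

Definition fz1 (A rb lam al beta : R) (th : R) : R :=
  zbar A rb - 1 / (2 * lam) *
    RInt (fun x => sin x ^ 2 / sqrt (sin x ^ 2 + 4 * lam ^ 2 * al ^ 2) - sin x)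
         (thbar1 A rb beta) th.

Definition fr2 (lam : R) (th : R) : R :=
  (sin th - sqrt (sin th ^ 2 + 4 * lam ^ 2)) / (2 * lam).

Definition fz2 (A rb lam beta : R) (th : R) : R :=
  zbar A rb - 1 / (2 * lam) *
    RInt (fun x => sin x ^ 2 / sqrt (sin x ^ 2 + 4 * lam ^ 2) - sin x)
         (thbar2 A rb beta) th.

Definition fr3 (A : R) (th : R) : R := A / sin th.

Definition fz3 (A : R) (th : R) : R := A * ln ((1 + cos th) / sin th).

(* [G] is the curve (r, z) on [a, b], reparametrized proportionally to
   arclength with the original parameter decreasing from [b] to [a]. *)
Definition decreasing_arclength_reparam
    (r z : R -> R) (a b : R) (G : C2curve) : Prop :=
  exists tau : R -> R,
    tau 0 = b /\ tau 1 = a /\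
    (forall t, unit_itv t -> continue_in tau unit_itv t) /\
    (forall s t, 0 <= s -> s < t -> t <= 1 -> tau t < tau s) /\
    (forall t, unit_itv t -> pt G t = (r (tau t), z (tau t))) /\
    (forall t, unit_itv t ->
       arclength (cr G) (cz G) 0 t = t * arclength (cr G) (cz G) 0 1).

Definition family_steady_state (A rb lam al beta thc : R) : Prop :=
  - PI < thbar1 A rb beta /\ thbar1 A rb beta < 0 /\
  0 < thbar2 A rb beta /\ thbar2 A rb beta < thbar3 A rb /\
  thbar3 A rb < PI / 2 /\
  exists G1 G2 G3 : C2curve,
    decreasing_arclength_reparam (fr1 lam al) (fz1 A rb lam al beta)
      (thbar1 A rb beta) thc G1 /\
    decreasing_arclength_reparam (fr2 lam) (fz2 A rb lam beta)
      0 (thbar2 A rb beta) G2 /\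
    decreasing_arclength_reparam (fr3 A) (fz3 A)
      (thbar3 A rb) (PI / 2) G3 /\
    steady_state beta thc G1 G2 G3.

Definition cond_P (A sigma rb lam al beta : R) : Prop :=
  rb = sqrt (sigma ^ 2 + A ^ 2) /\ 0 < rb < 1 /\
  zbar A rb = A * arccosh (sqrt (sigma ^ 2 + A ^ 2) / A) /\ 0 < zbar A rb /\
  thbar3 A rb = asin (A / sqrt (sigma ^ 2 + A ^ 2)) /\
  thbar1 A rb beta = thbar3 A rb - beta /\
  thbar2 A rb beta = thbar3 A rb + beta - PI /\
  0 < thbar3 A rb < PI / 2 /\
  - PI < thbar1 A rb beta < 0 /\
  0 < thbar2 A rb beta < thbar3 A rb /\
  lam = (A * cos beta + sigma * sin beta) / (1 - A ^ 2 - sigma ^ 2) /\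
  lam < 0 /\
  al = sqrt (((2 * A ^ 2 + 2 * sigma ^ 2 - 1) * A * cos beta
                + sigma * sin beta)
             / (A * cos beta + sigma * sin beta)) /\
  0 < al < 1.

Definition cond_N (A sigma rb lam al beta thc : R) : Prop :=
  tan beta > A / sigma * (1 - 2 * A ^ 2 - 2 * sigma ^ 2) /\
  (cos beta < - (A / sqrt (sigma ^ 2 + A ^ 2)) ->
     cos beta < - (1 / (2 * A))) /\
  fz1 A rb lam al beta thc = 0 /\
  (forall p : R * R,
     trace (fr1 lam al) (fz1 A rb lam al beta) (thbar1 A rb beta) thc p /\
     trace (fr3 A) (fz3 A) (thbar3 A rb) (PI / 2) p
     <-> p = (rb, zbar A rb)).

(* Main.v *)
Require Import Defs.
From Stdlib Require Import Reals Lra Ranalysis5.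
From Coquelicot Require Import Coquelicot.
Open Scope R_scope.

(** The three curves are parametrized by their tangent angle [th]: the velocity
    is a positive density times the unit vector of angle [th]. Reparametrizing
    by arclength turns such data into a curve of class C^2 whose mean curvature
    and tangent angle are explicit ([arclength_reparam_exists]). It remains to
    see which parameters give the right end points and no forbidden crossing.

    The catenary has length [sqrt (rb ^ 2 - A ^ 2)], so the length condition is
    [rb ^ 2 = sigma ^ 2 + A ^ 2]. The other two are arcs of the nodoids
    [r * sin th = lam * (r ^ 2 - a ^ 2)], with [a = al] for the first and
    [a = 1] for the second ([fr1_first_integral]). Reaching radius 1 at angle 0
    forces [lam < 0]. Reaching the junction radius at the angles prescribed there
    gives two equations, linear in [lam] and [lam * al ^ 2], whose solutions are
    the stated formulas ([junction_equations]). Their difference is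
    [lam * (1 - al ^ 2) = 2 * A * cos beta].
    Positivity of [al] is the inequality on [tan beta]. If the angle
    [- PI / 2] occurs on the first nodoid, the radius is largest there, and by
    the first integral it is smaller than 1 exactly when
    [lam * (1 - al ^ 2) < - 1], that is [cos beta < - 1 / (2 * A)].

    Conversely, the absence of crossings comes from one observation: the
    [height] above a line of direction [phi] is monotone on each half turn of
    angles starting at [phi]. With [phi = 0] this makes each curve simple and
    gives the sign of [z]; with [phi = PI / 2] it bounds the radius; and the
    tangent line of the second nodoid at the junction separates it from the
    first ([separated_by_tangent]). Crossings of the first nodoid with the
    catenary are excluded by hypothesis, and this also places the foot of the
    nodoid inside that of the catenary, since otherwise the intermediate value
    theorem would produce a crossing ([nodoid_foot_inside]). *)

(** * Calculus on closed intervals *)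

Lemma D_in_unit_of_is_derive (f f1 : R -> R) (t : R) :
  is_derive f t (f1 t) -> D_in f f1 unit_itv t.
Proof.
intros H; apply (D_in_imp f f1 no_cond); [intros; exact I|].
apply derivable_pt_lim_D_in, is_derive_Reals, H.
Qed.

Lemma continue_in_unit_of_continuous (f : R -> R) (t : R) :
  continuous f t -> continue_in f unit_itv t.
Proof.
intros H; apply continuity_pt_filterlim in H.
intros eps Heps; destruct (H eps Heps) as [d [Hd K]].
exists d; split; [exact Hd|].
intros x [[_ Hx] Hdist]; apply K; repeat split; auto.
Qed.

(** Clamping the argument to the interval turns one-sided continuity into
    continuity on the line, where the intermediate value theorem applies. *)
Lemma unit_ivt (f : R -> R) (y : R) :
  (forall t, unit_itv t -> continue_in f unit_itv t) ->
  f 1 <= y <= f 0 -> exists t, unit_itv t /\ f t = y.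
Proof.
intros Hf Hy.
pose (cl := fun x => Rmax 0 (Rmin x 1)).
assert (Hcl : forall x, unit_itv (cl x)).
{ intros x; unfold cl, unit_itv, Rmax, Rmin.
  repeat destruct (Rle_dec _ _); lra. }
assert (Hlip : forall x x', Rabs (cl x - cl x') <= Rabs (x - x')).
{ intros x x'; unfold cl, Rmax, Rmin, Rabs.
  repeat destruct (Rle_dec _ _); repeat destruct (Rcase_abs _); lra. }
assert (Hc : continuity (fun x => f (cl x))).
{ intros x eps Heps.
  destruct (Hf (cl x) (Hcl x) eps Heps) as [d [Hd K]].
  exists d; split; [exact Hd|]; simpl; unfold Rdist.
  intros x' [_ Hx'].
  destruct (Req_dec (cl x') (cl x)) as [E|E].
  - rewrite E, Rminus_diag, Rabs_R0; exact Heps.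
  - apply K; split; [split; [apply Hcl|congruence]|].
    simpl; unfold Rdist; specialize (Hlip x' x); lra. }
assert (E0 : cl 0 = 0) by (unfold cl; rewrite Rmin_left, Rmax_left; lra).
assert (E1 : cl 1 = 1) by (unfold cl; rewrite Rmin_left, Rmax_right; lra).
destruct (IVT_gen (fun x => f (cl x)) 0 1 y Hc) as [x [_ Hx]].
{ rewrite E0, E1, Rmin_right, Rmax_left; lra. }
exists (cl x); auto.
Qed.

Lemma decreasing_of_derive_neg (f df : R -> R) (a b : R) :
  a < b -> (forall x, a <= x <= b -> is_derive f x (df x)) ->
  (forall x, a < x < b -> df x < 0) -> f b < f a.
Proof.
intros Hab Hd Hn.
destruct (MVT_cor2 f df a b Hab) as [c [E Hc]].
{ intros c Hc; apply is_derive_Reals, Hd, Hc. }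
specialize (Hn c Hc); nra.
Qed.

Lemma increasing_of_derive_pos (f df : R -> R) (a b : R) :
  a < b -> (forall x, a <= x <= b -> is_derive f x (df x)) ->
  (forall x, a < x < b -> 0 < df x) -> f a < f b.
Proof.
intros Hab Hd Hn.
destruct (MVT_cor2 f df a b Hab) as [c [E Hc]].
{ intros c Hc; apply is_derive_Reals, Hd, Hc. }
specialize (Hn c Hc); nra.
Qed.

Lemma is_derive_inverse (S g u : R -> R) :
  (forall x, is_derive S x (g x)) -> (forall x, 0 < g x) ->
  (forall y, S (u y) = y) ->
  forall y, is_derive u y (/ g (u y)).
Proof.
intros HS Hg Hu y.
assert (Sinc : forall x x', x < x' -> S x < S x').
{ intros x x' H; apply (increasing_of_derive_pos S g); auto. }
assert (uinc : forall v w, v < w -> u v < u w).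
{ intros v w H; apply Rnot_le_lt; intros [K|K].
  - apply Sinc in K; rewrite !Hu in K; lra.
  - apply (f_equal S) in K; rewrite !Hu in K; lra. }
assert (Hc : continuity_pt u y).
{ intros eps Heps.
  assert (H1 : S (u y - eps) < y) by (rewrite <- (Hu y) at 2; apply Sinc; lra).
  assert (H2 : y < S (u y + eps)) by (rewrite <- (Hu y) at 1; apply Sinc; lra).
  exists (Rmin (y - S (u y - eps)) (S (u y + eps) - y)); split.
  { apply Rmin_glb_lt; lra. }
  simpl; unfold Rdist; intros v [_ Hv].
  pose proof (Rmin_l (y - S (u y - eps)) (S (u y + eps) - y)).
  pose proof (Rmin_r (y - S (u y - eps)) (S (u y + eps) - y)).
  apply Rabs_def2 in Hv.
  apply Rabs_def1; apply Rnot_le_lt; intros K.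
  - assert (K' : S (u y + eps) <= S (u v)).
    { destruct (Req_dec (u v) (u y + eps)) as [->|N]; [lra|].
      left; apply Sinc; lra. }
    rewrite Hu in K'; lra.
  - assert (K' : S (u v) <= S (u y - eps)).
    { destruct (Req_dec (u v) (u y - eps)) as [->|N]; [lra|].
      left; apply Sinc; lra. }
    rewrite Hu in K'; lra. }
assert (Prf : forall a, u (y - 1) <= a <= u (y + 1) -> derivable_pt S a).
{ intros a _; exists (g a); apply is_derive_Reals, HS. }
assert (Hin : u (y - 1) <= u y <= u (y + 1)) by (split; left; apply uinc; lra).
assert (E : derive_pt S (u y) (Prf (u y) Hin) = g (u y)).
{ apply derive_pt_eq_0, is_derive_Reals, HS. }
pose proof (Hg (u y)) as Hpos.
apply is_derive_Reals; replace (/ g (u y)) with (1 / g (u y)) by (field; lra).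
rewrite <- E.
apply derivable_pt_lim_recip_interv; try lra; auto.
- intros x _; apply Hu.
Qed.

(** The density is extended by its end values outside the interval, so that its
    primitive is a bijection of the line: the inverse is then differentiable
    from both sides even at the ends of [0,1]. *)
Lemma decreasing_arclength_inverse (g : R -> R) (a b : R) :
  a < b -> (forall x, a <= x <= b -> 0 < g x /\ continuous g x) ->
  exists (L : R) (tau : R -> R),
    0 < L /\ tau 0 = b /\ tau 1 = a /\
    (forall s t, s < t -> tau t < tau s) /\
    (forall t, 0 <= t <= 1 -> is_derive tau t (- (L / g (tau t)))).
Proof.
intros Hab Hg.
pose (cl := fun x => Rmax a (Rmin x b)).
assert (Hcl : forall x, a <= cl x <= b).
{ intros x; unfold cl, Rmax, Rmin; repeat destruct (Rle_dec _ _); lra. }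
assert (Hid : forall x, a <= x <= b -> cl x = x).
{ intros x Hx; unfold cl; rewrite Rmin_left, Rmax_right; lra. }
assert (Hlip : forall x x', Rabs (cl x - cl x') <= Rabs (x - x')).
{ intros x x'; unfold cl, Rmax, Rmin, Rabs.
  repeat destruct (Rle_dec _ _); repeat destruct (Rcase_abs _); lra. }
pose (h := fun x => g (cl x)).
assert (Hh : forall x, continuous h x).
{ intros x; unfold h; apply continuous_comp; [|apply Hg, Hcl].
  apply continuity_pt_filterlim; intros eps Heps; exists eps; split; [auto|].
  simpl; unfold Rdist; intros x' [_ K]; specialize (Hlip x' x); lra. }
assert (Hh0 : forall x, 0 < h x) by (intros x; apply Hg, Hcl).
destruct (continuity_ab_min g a b) as [m [Hm1 Hm2]]; [lra| |].
{ intros c Hc; apply continuity_pt_filterlim, Hg, Hc. }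
assert (Hm0 : 0 < g m) by (apply Hg, Hm2).
pose (S := (fun x => RInt h a x) : R -> R).
assert (HS : forall x, is_derive S x (h x)).
{ intros x; apply (is_derive_RInt h S a x); [|apply Hh].
  apply filter_forall; intros y; apply (RInt_correct h a y).
  apply (ex_RInt_continuous h); intros; apply Hh. }
assert (Sinc : forall x x', x < x' -> S x < S x').
{ intros x x' H; apply (increasing_of_derive_pos S h); auto. }
assert (Sgrow : forall x x', x < x' -> g m * (x' - x) <= S x' - S x).
{ intros x x' H.
  destruct (MVT_cor2 S h x x' H) as [c [E _]].
  { intros c _; apply is_derive_Reals, HS. }
  rewrite E; apply Rmult_le_compat_r; [lra|]; apply Hm1, Hcl. }
assert (Sa : S a = 0) by apply (RInt_point a h).
assert (Sc : continuity S).
{ intros x; apply derivable_continuous_pt; exists (h x).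
  apply is_derive_Reals, HS. }
assert (Ssurj : forall y, { x | S x = y }).
{ intros y.
  pose (w := 1 + Rabs y / g m).
  assert (Hw : 0 < w).
  { unfold w; pose proof (Rabs_pos y).
    assert (0 <= Rabs y / g m) by (apply Rdiv_le_0_compat; lra); lra. }
  assert (Ew : g m * w = g m + Rabs y) by (unfold w; field; lra).
  pose proof (Sgrow a (a + w) ltac:(lra)) as K1.
  pose proof (Sgrow (a - w) a ltac:(lra)) as K2.
  replace (a + w - a) with w in K1 by ring.
  replace (a - (a - w)) with w in K2 by ring.
  pose proof (Rle_abs y) as K3; pose proof (Rle_abs (- y)) as K4.
  rewrite Rabs_Ropp in K4.
  destruct (IVT_gen S (a - w) (a + w) y Sc) as [x [_ Hx]].
  { rewrite Rmin_left, Rmax_right; lra. }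
  exists x; exact Hx. }
pose (u := fun y => proj1_sig (Ssurj y)).
assert (Hu : forall y, S (u y) = y) by (intros y; exact (proj2_sig (Ssurj y))).
assert (uinc : forall v w, v < w -> u v < u w).
{ intros v w H; apply Rnot_le_lt; intros [K|K].
  - apply Sinc in K; rewrite !Hu in K; lra.
  - apply (f_equal S) in K; rewrite !Hu in K; lra. }
assert (HuS : forall x, u (S x) = x).
{ intros x; destruct (Rtotal_order (u (S x)) x) as [K|[K|K]]; [|exact K|];
    apply Sinc in K; rewrite Hu in K; lra. }
pose (L := S b).
assert (HL : 0 < L) by (unfold L; rewrite <- Sa; apply Sinc, Hab).
pose (tau := fun t => u (L * (1 - t))).
assert (T0 : tau 0 = b) by (unfold tau; rewrite Rminus_0_r, Rmult_1_r; apply HuS).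
assert (T1 : tau 1 = a).
{ unfold tau; replace (L * (1 - 1)) with (S a) by (rewrite Sa; ring); apply HuS. }
assert (Td : forall s t, s < t -> tau t < tau s).
{ intros s t H; unfold tau; apply uinc; nra. }
exists L, tau; split; [exact HL|]; split; [exact T0|]; split; [exact T1|].
split; [exact Td|].
intros t Ht.
assert (Hr : a <= tau t <= b).
{ split.
  - rewrite <- T1; destruct (Req_dec t 1) as [->|N]; [lra|left; apply Td; lra].
  - rewrite <- T0; destruct (Req_dec t 0) as [->|N]; [lra|left; apply Td; lra]. }
assert (Hd : is_derive u (L * (1 - t)) (/ g (tau t))).
{ rewrite <- (Hid (tau t) Hr); apply (is_derive_inverse S h u); auto. }
assert (Hlin : is_derive (fun t => L * (1 - t)) t (- L)).
{ auto_derive; [exact I|ring]. }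
evar_last.
- exact (is_derive_comp u (fun t => L * (1 - t)) t _ _ Hd Hlin).
- assert (0 < g (tau t)) by (apply Hg, Hr).
  change (- L * / g (tau t) = - (L / g (tau t))); field; lra.
Qed.

(** * Curves parametrized by their tangent angle *)

(** The curve is run through with the angle decreasing, so the velocity at
    angle [th] is [- g th] times the unit vector of angle [th]; [g] is the
    radius of curvature. *)
Definition angle_param (r z g : R -> R) (a b : R) : Prop :=
  forall th, a <= th <= b ->
    0 < g th /\ continuous g th /\
    is_derive r th (- (g th * cos th)) /\
    is_derive z th (- (g th * sin th)).

Lemma arclength_angle_param (r z g : R -> R) (a b : R) :
  a <= b -> angle_param r z g a b -> arclength r z a b = RInt g a b.
Proof.
intros Hab H; apply RInt_ext.
rewrite Rmin_left, Rmax_right by lra; intros x Hx.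
destruct (H x) as (Hg & _ & Hr & Hz); [lra|].
rewrite (is_derive_unique _ _ _ Hr), (is_derive_unique _ _ _ Hz).
replace ((- (g x * cos x)) ^ 2 + (- (g x * sin x)) ^ 2) with (g x ^ 2).
- apply sqrt_pow2; lra.
- pose proof (sin2_cos2 x) as E; unfold Rsqr in E.
  transitivity (g x ^ 2 * (sin x * sin x + cos x * cos x)); [rewrite E|]; ring.
Qed.

(** Projecting on the normal of direction [phi]: along the curve this height
    has derivative proportional to [- sin (th - phi)], so it is monotone on
    either half turn of angles starting at [phi]. *)
Definition height (phi x y : R) : R := y * cos phi - x * sin phi.

Lemma height_derive (r z g : R -> R) (a b phi th : R) :
  angle_param r z g a b -> a <= th <= b ->
  is_derive (fun th => height phi (r th) (z th)) th (- (g th * sin (th - phi))).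
Proof.
intros H Hth; destruct (H th Hth) as (_ & _ & Hr & Hz).
unfold height; auto_derive.
- split; [eexists; exact Hz|split; [eexists; exact Hr|exact I]].
- rewrite (is_derive_unique (fun x : R => r x) _ _ Hr),
          (is_derive_unique (fun x : R => z x) _ _ Hz), sin_minus.
  ring.
Qed.

Lemma height_decreasing (r z g : R -> R) (a b phi s t : R) :
  angle_param r z g a b -> a <= s -> s < t -> t <= b ->
  phi <= s -> t <= phi + PI ->
  height phi (r t) (z t) < height phi (r s) (z s).
Proof.
intros H Has Hst Htb Hs Ht.
apply (decreasing_of_derive_neg (fun th => height phi (r th) (z th))
         (fun th => - (g th * sin (th - phi))) s t Hst).
- intros x Hx; apply (height_derive r z g a b); auto; lra.
- intros x Hx; destruct (H x) as (Hg & _); [lra|].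
  assert (0 < sin (x - phi)) by (apply sin_gt_0; lra); nra.
Qed.

Lemma height_increasing (r z g : R -> R) (a b phi s t : R) :
  angle_param r z g a b -> a <= s -> s < t -> t <= b ->
  phi - PI <= s -> t <= phi ->
  height phi (r s) (z s) < height phi (r t) (z t).
Proof.
intros H Has Hst Htb Hs Ht.
apply (increasing_of_derive_pos (fun th => height phi (r th) (z th))
         (fun th => - (g th * sin (th - phi))) s t Hst).
- intros x Hx; apply (height_derive r z g a b); auto; lra.
- intros x Hx; destruct (H x) as (Hg & _); [lra|].
  assert (0 < sin (phi - x)) by (apply sin_gt_0; lra).
  replace (x - phi) with (- (phi - x)) by ring; rewrite sin_neg; nra.
Qed.

Lemma z_decreasing (r z g : R -> R) (a b s t : R) :
  angle_param r z g a b -> a <= s -> s < t -> t <= b ->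
  0 <= s -> t <= PI -> z t < z s.
Proof.
intros H Has Hst Htb Hs Ht.
pose proof (height_decreasing r z g a b 0 s t H Has Hst Htb Hs) as K.
unfold height in K; rewrite cos_0, sin_0 in K; lra.
Qed.

Lemma z_increasing (r z g : R -> R) (a b s t : R) :
  angle_param r z g a b -> a <= s -> s < t -> t <= b ->
  - PI <= s -> t <= 0 -> z s < z t.
Proof.
intros H Has Hst Htb Hs Ht.
pose proof (height_increasing r z g a b 0 s t H Has Hst Htb) as K.
unfold height in K; rewrite cos_0, sin_0 in K; lra.
Qed.

Lemma r_decreasing (r z g : R -> R) (a b s t : R) :
  angle_param r z g a b -> a <= s -> s < t -> t <= b ->
  - (PI / 2) <= s -> t <= PI / 2 -> r t < r s.
Proof.
intros H Has Hst Htb Hs Ht.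
pose proof (height_increasing r z g a b (PI / 2) s t H Has Hst Htb) as K.
unfold height in K; rewrite cos_PI2, sin_PI2 in K; lra.
Qed.

(** Traversed at constant speed [L], the curve has velocity [L] times the unit
    vector of its angle, and the angle itself solves [tau' = - L / g tau]; all
    second order data of the curve can be read off from these two facts. *)
Lemma arclength_reparam_exists (r z g : R -> R) (a b : R) :
  a < b -> angle_param r z g a b ->
  (forall th, a <= th <= b -> 0 < r th) ->
  exists (G : C2curve) (tau : R -> R),
    decreasing_arclength_reparam r z a b G /\
    tau 0 = b /\ tau 1 = a /\
    (forall s t, s < t -> tau t < tau s) /\
    (forall t, unit_itv t ->
       a <= tau t <= b /\ cr G t = r (tau t) /\ cz G t = z (tau t) /\
       mean_curv G t = (sin (tau t) / r (tau t) - / g (tau t)) / 2) /\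
    constant_speed G /\
    (- PI < a -> b <= PI -> tangent_angle G tau).
Proof.
intros Hab H Hrpos.
destruct (decreasing_arclength_inverse g a b Hab) as
  (L & tau & HL & T0 & T1 & Td & Tder).
{ intros x Hx; destruct (H x Hx) as (? & ? & _); auto. }
assert (Hr : forall t, unit_itv t -> a <= tau t <= b).
{ intros t [Ht0 Ht1]; split.
  - rewrite <- T1; destruct (Req_dec t 1) as [->|N]; [lra|left; apply Td; lra].
  - rewrite <- T0; destruct (Req_dec t 0) as [->|N]; [lra|left; apply Td; lra]. }
pose (r1 := fun t => L * cos (tau t)).
pose (z1 := fun t => L * sin (tau t)).
pose (r2 := fun t => L ^ 2 * sin (tau t) / g (tau t)).
pose (z2 := fun t => - (L ^ 2 * cos (tau t) / g (tau t))).
assert (Tc : forall t, unit_itv t -> continuous tau t).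
{ intros t Ht; apply (ex_derive_continuous tau); eexists; apply Tder, Ht. }
assert (gc : forall t, unit_itv t -> continuous (fun t => g (tau t)) t).
{ intros t Ht; apply continuous_comp; [apply Tc, Ht|].
  apply H, Hr, Ht. }
assert (Dr : forall t, unit_itv t -> is_derive (fun t => r (tau t)) t (r1 t)).
{ intros t Ht; destruct (H _ (Hr t Ht)) as (Hg & _ & Kr & _).
  evar_last; [exact (is_derive_comp r tau t _ _ Kr (Tder t Ht))|].
  unfold r1; change (- (L / g (tau t)) * - (g (tau t) * cos (tau t))
                     = L * cos (tau t)); field; lra. }
assert (Dz : forall t, unit_itv t -> is_derive (fun t => z (tau t)) t (z1 t)).
{ intros t Ht; destruct (H _ (Hr t Ht)) as (Hg & _ & _ & Kz).
  evar_last; [exact (is_derive_comp z tau t _ _ Kz (Tder t Ht))|].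
  unfold z1; change (- (L / g (tau t)) * - (g (tau t) * sin (tau t))
                     = L * sin (tau t)); field; lra. }
assert (Dr1 : forall t, unit_itv t -> is_derive r1 t (r2 t)).
{ intros t Ht; destruct (H _ (Hr t Ht)) as (Hg & _).
  unfold r1, r2; auto_derive; [eexists; apply Tder, Ht|].
  rewrite (is_derive_unique (fun x : R => tau x) _ _ (Tder t Ht)); field; lra. }
assert (Dz1 : forall t, unit_itv t -> is_derive z1 t (z2 t)).
{ intros t Ht; destruct (H _ (Hr t Ht)) as (Hg & _).
  unfold z1, z2; auto_derive; [eexists; apply Tder, Ht|].
  rewrite (is_derive_unique (fun x : R => tau x) _ _ (Tder t Ht)); field; lra. }
assert (Cinv : forall t, unit_itv t -> continuous (fun t => / g (tau t)) t).
{ intros t Ht; destruct (H _ (Hr t Ht)) as (Hg & _).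
  apply (continuous_Rinv_comp (fun t => g (tau t))); [apply gc, Ht|lra]. }
assert (Cr2 : forall t, unit_itv t -> continuous r2 t).
{ intros t Ht.
  apply (continuous_mult (fun t => L ^ 2 * sin (tau t)) (fun t => / g (tau t)));
    [|apply Cinv, Ht].
  apply (continuous_mult (fun _ => L ^ 2)); [apply continuous_const|].
  apply continuous_comp; [apply Tc, Ht|apply continuous_sin]. }
assert (Cz2 : forall t, unit_itv t -> continuous z2 t).
{ intros t Ht; unfold z2.
  apply (continuous_opp (fun t => L ^ 2 * cos (tau t) / g (tau t))).
  apply (continuous_mult (fun t => L ^ 2 * cos (tau t)) (fun t => / g (tau t)));
    [|apply Cinv, Ht].
  apply (continuous_mult (fun _ => L ^ 2)); [apply continuous_const|].
  apply continuous_comp; [apply Tc, Ht|apply continuous_cos]. }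
assert (C2r : C2_unit (fun t => r (tau t)) r1 r2).
{ intros t Ht; split; [|split].
  - apply D_in_unit_of_is_derive, Dr, Ht.
  - apply D_in_unit_of_is_derive, Dr1, Ht.
  - apply continue_in_unit_of_continuous, Cr2, Ht. }
assert (C2z : C2_unit (fun t => z (tau t)) z1 z2).
{ intros t Ht; split; [|split].
  - apply D_in_unit_of_is_derive, Dz, Ht.
  - apply D_in_unit_of_is_derive, Dz1, Ht.
  - apply continue_in_unit_of_continuous, Cz2, Ht. }
pose (G := mkC2curve _ _ _ _ _ _ C2r C2z).
assert (Hspeed : forall t, speed2 G t = L ^ 2).
{ intros t; unfold speed2; simpl cr1; simpl cz1; unfold r1, z1.
  pose proof (sin2_cos2 (tau t)) as E; unfold Rsqr in E.
  transitivity (L ^ 2 * (sin (tau t) * sin (tau t) + cos (tau t) * cos (tau t)));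
    [|rewrite E]; ring. }
assert (Hsqrt : sqrt (L ^ 2) = L) by (apply sqrt_pow2; lra).
assert (Hlen : forall t, unit_itv t -> arclength (cr G) (cz G) 0 t = t * L).
{ intros t Ht; unfold arclength.
  rewrite (RInt_ext _ (fun _ => L)).
  - rewrite RInt_const; change (scal (t - 0) L) with ((t - 0) * L); ring.
  - rewrite Rmin_left, Rmax_right by apply Ht; intros x Hx.
    assert (Hx1 : unit_itv x) by (unfold unit_itv in *; lra).
    simpl cr; simpl cz.
    rewrite (is_derive_unique (fun t : R => r (tau t)) _ _ (Dr x Hx1)),
            (is_derive_unique (fun t : R => z (tau t)) _ _ (Dz x Hx1)).
    rewrite <- Hsqrt, <- (Hspeed x); reflexivity. }
exists G, tau; split; [|split; [exact T0|split; [exact T1|split; [exact Td|]]]].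
{ exists tau; split; [exact T0|split; [exact T1|]].
  split; [|split; [|split]].
  - intros t Ht; apply continue_in_unit_of_continuous, Tc, Ht.
  - intros s t _ Hst _; apply Td, Hst.
  - reflexivity.
  - intros t Ht; rewrite !Hlen; auto; unfold unit_itv; lra. }
split; [|split].
- intros t Ht; split; [apply Hr, Ht|split; [reflexivity|split; [reflexivity|]]].
  destruct (H _ (Hr t Ht)) as (Hg & _).
  pose proof (Hrpos _ (Hr t Ht)) as Hr0.
  unfold mean_curv; rewrite Hspeed, Hsqrt.
  replace (Rpower (L ^ 2) (3 / 2)) with (L ^ 3).
  2:{ rewrite <- (Rpower_pow 2 L HL), Rpower_mult.
      replace (INR 2 * (3 / 2)) with (INR 3) by (simpl; field).
      symmetry; apply Rpower_pow, HL. }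
  simpl; unfold r1, z1, r2, z2.
  pose proof (sin2_cos2 (tau t)) as E; unfold Rsqr in E.
  transitivity (sin (tau t) / r (tau t) / 2
    - (sin (tau t) * sin (tau t) + cos (tau t) * cos (tau t)) / g (tau t) / 2);
    [|rewrite E]; field; lra.
- exists (L ^ 2); split; [nra|]; intros; apply Hspeed.
- intros Ha Hb t Ht; split; [|split; [|split]].
  + apply continue_in_unit_of_continuous, Tc, Ht.
  + pose proof (Hr t Ht); lra.
  + rewrite Hspeed, Hsqrt; simpl; unfold r1; field; lra.
  + rewrite Hspeed, Hsqrt; simpl; unfold z1; field; lra.
Qed.

Lemma reparam_start (r z : R -> R) (a b : R) (G : C2curve) :
  decreasing_arclength_reparam r z a b G -> pt G 0 = (r b, z b).
Proof.
intros (tau & T0 & _ & _ & _ & Hpt & _).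
rewrite Hpt, T0; [reflexivity|unfold unit_itv; lra].
Qed.

Lemma reparam_end (r z : R -> R) (a b : R) (G : C2curve) :
  decreasing_arclength_reparam r z a b G -> pt G 1 = (r a, z a).
Proof.
intros (tau & _ & T1 & _ & _ & Hpt & _).
rewrite Hpt, T1; [reflexivity|unfold unit_itv; lra].
Qed.

Lemma reparam_onto (r z : R -> R) (a b : R) (G : C2curve) (th : R) :
  decreasing_arclength_reparam r z a b G -> a <= th <= b ->
  exists t, unit_itv t /\ pt G t = (r th, z th).
Proof.
intros (tau & T0 & T1 & Hc & _ & Hpt & _) Hth.
destruct (unit_ivt tau th Hc) as [t [Ht <-]]; [rewrite T0, T1; exact Hth|].
exists t; split; auto.
Qed.

Lemma simple_of_angle_injective (G : C2curve) (tau r z : R -> R) (a b : R) :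
  (forall s t, s < t -> tau t < tau s) ->
  (forall t, unit_itv t ->
     a <= tau t <= b /\ cr G t = r (tau t) /\ cz G t = z (tau t)) ->
  (forall th th', a <= th -> th < th' -> th' <= b ->
     r th = r th' -> z th <> z th') ->
  simple G.
Proof.
intros D V I s t Hs Ht E; injection E; intros Ez Er.
destruct (V s Hs) as (Is & Rs & Zs); destruct (V t Ht) as (It & Rt & Zt).
rewrite Rs, Rt in Er; rewrite Zs, Zt in Ez.
destruct (Rtotal_order s t) as [K|[K|K]]; [exfalso|exact K|exfalso];
  apply D in K.
- apply (I (tau t) (tau s)); auto; lra.
- apply (I (tau s) (tau t)); auto; lra.
Qed.

(** * Nodoids *)

Lemma nodoid_radicand_pos (lam a th : R) :
  lam <> 0 -> 0 < a -> 0 < sin th ^ 2 + 4 * lam ^ 2 * a ^ 2.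
Proof.
intros Hl Ha.
assert (0 < lam ^ 2) by (apply pow2_gt_0; lra).
assert (0 < a ^ 2) by (apply pow2_gt_0; lra).
pose proof (pow2_ge_0 (sin th)); nra.
Qed.

Lemma nodoid_sqrt_pos (lam a th : R) :
  lam <> 0 -> 0 < a -> 0 < sqrt (sin th ^ 2 + 4 * lam ^ 2 * a ^ 2).
Proof. intros Hl Ha; apply sqrt_lt_R0, nodoid_radicand_pos; auto. Qed.

(** The radius is the positive root of a quadratic equation, which is the first
    integral of the constant mean curvature equation (balance of forces along
    the axis of rotation). All conditions on the nodoids are read off from it. *)
Lemma fr1_first_integral (lam a th rho : R) :
  lam < 0 -> 0 < rho ->
  fr1 lam a th = rho <-> rho * sin th = lam * (rho ^ 2 - a ^ 2).
Proof.
intros Hl Hrho; unfold fr1.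
set (q := sqrt (sin th ^ 2 + 4 * lam ^ 2 * a ^ 2)).
assert (Hq0 : 0 <= sin th ^ 2 + 4 * lam ^ 2 * a ^ 2).
{ pose proof (pow2_ge_0 (sin th)); pose proof (pow2_ge_0 lam).
  pose proof (pow2_ge_0 a); nra. }
assert (Hq : q * q = sin th ^ 2 + 4 * lam ^ 2 * a ^ 2) by (apply sqrt_sqrt, Hq0).
split; intros H.
- assert (E : q = sin th - 2 * lam * rho) by (rewrite <- H; field; lra).
  rewrite E in Hq.
  apply (Rmult_eq_reg_l (4 * lam)); [|lra]; lra.
- assert (Hp : 0 <= sin th - 2 * lam * rho).
  { pose proof (pow2_ge_0 a); apply (Rmult_le_reg_l rho); nra. }
  assert (E : q = sin th - 2 * lam * rho).
  { unfold q.
    replace (sin th ^ 2 + 4 * lam ^ 2 * a ^ 2) with ((sin th - 2 * lam * rho) ^ 2).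
    - apply sqrt_pow2, Hp.
    - transitivity (sin th ^ 2 - 4 * lam * (rho * sin th) + 4 * lam ^ 2 * rho ^ 2);
        [|rewrite H]; ring. }
  rewrite E; field; lra.
Qed.

Lemma fr1_pos (lam a th : R) : lam < 0 -> 0 < a -> 0 < fr1 lam a th.
Proof.
intros Hl Ha; unfold fr1.
assert (K : 0 < 4 * lam ^ 2 * a ^ 2).
{ assert (0 < lam ^ 2) by (apply pow2_gt_0; lra).
  assert (0 < a ^ 2) by (apply pow2_gt_0; lra); nra. }
assert (Hs : sin th < sqrt (sin th ^ 2 + 4 * lam ^ 2 * a ^ 2)).
{ apply Rle_lt_trans with (Rabs (sin th)); [apply Rle_abs|].
  rewrite <- sqrt_Rsqr_abs; apply sqrt_lt_1_alt; unfold Rsqr.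
  pose proof (pow2_ge_0 (sin th)); nra. }
replace ((sin th - sqrt (sin th ^ 2 + 4 * lam ^ 2 * a ^ 2)) / (2 * lam))
  with ((sqrt (sin th ^ 2 + 4 * lam ^ 2 * a ^ 2) - sin th) / (- (2 * lam)))
  by (field; lra).
apply Rdiv_lt_0_compat; lra.
Qed.

(** By the first integral, [sin th] is the decreasing function
    [lam * (rho - a ^ 2 / rho)] of the radius [rho]. *)
Lemma fr1_lt (lam a th rho : R) :
  lam < 0 -> 0 < a -> 0 < rho ->
  fr1 lam a th < rho <-> lam * (rho ^ 2 - a ^ 2) < rho * sin th.
Proof.
intros Hl Ha Hrho.
pose proof (fr1_pos lam a th Hl Ha) as Hx.
destruct (fr1_first_integral lam a th (fr1 lam a th) Hl Hx) as [K _].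
specialize (K eq_refl); set (x := fr1 lam a th) in *.
assert (E : x * (rho * sin th - lam * (rho ^ 2 - a ^ 2))
            = - lam * (rho * x + a ^ 2) * (rho - x)).
{ transitivity (rho * (x * sin th) - x * lam * (rho ^ 2 - a ^ 2));
    [|rewrite K]; ring. }
assert (P : 0 < - lam * (rho * x + a ^ 2)).
{ assert (0 < a ^ 2) by (apply pow2_gt_0; lra).
  apply Rmult_lt_0_compat; nra. }
split; intros H.
- apply (Rmult_lt_reg_l x); [exact Hx|]; nra.
- apply Rlt_0_minus, (Rmult_lt_reg_l _ _ _ P); nra.
Qed.

Lemma fr1_antitone_sin (lam a th th' : R) :
  lam < 0 -> 0 < a -> sin th' < sin th -> fr1 lam a th < fr1 lam a th'.
Proof.
intros Hl Ha Hs.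
pose proof (fr1_pos lam a th' Hl Ha) as Hx.
apply fr1_lt; auto.
destruct (fr1_first_integral lam a th' _ Hl Hx) as [K _].
rewrite <- (K eq_refl); apply Rmult_lt_compat_l; lra.
Qed.

Definition nodoid_radius_of_curvature (lam a th : R) : R :=
  fr1 lam a th / sqrt (sin th ^ 2 + 4 * lam ^ 2 * a ^ 2).

Lemma fr1_derive (lam a th : R) :
  lam <> 0 -> 0 < a ->
  is_derive (fr1 lam a) th (- (nodoid_radius_of_curvature lam a th * cos th)).
Proof.
intros Hl Ha; pose proof (nodoid_sqrt_pos lam a th Hl Ha) as Hq.
pose proof (nodoid_radicand_pos lam a th Hl Ha) as Hq2.
unfold nodoid_radius_of_curvature, fr1.
auto_derive; [assumption|].
simpl in *; field; split; lra.
Qed.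

Lemma nodoid_height_integrand_continuous (lam a th : R) :
  lam <> 0 -> 0 < a ->
  continuous
    (fun x => sin x ^ 2 / sqrt (sin x ^ 2 + 4 * lam ^ 2 * a ^ 2) - sin x) th.
Proof.
intros Hl Ha; pose proof (nodoid_sqrt_pos lam a th Hl Ha) as Hq.
pose proof (nodoid_radicand_pos lam a th Hl Ha) as Hq2.
apply (ex_derive_continuous (V := R_NormedModule)).
auto_derive; repeat split; simpl in *; lra.
Qed.

Lemma nodoid_height_derive (lam a th0 z0 th : R) :
  lam <> 0 -> 0 < a ->
  is_derive
    (fun t => z0 - 1 / (2 * lam) *
       RInt (fun x => sin x ^ 2 / sqrt (sin x ^ 2 + 4 * lam ^ 2 * a ^ 2) - sin x)
            th0 t)
    th (- (nodoid_radius_of_curvature lam a th * sin th)).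
Proof.
intros Hl Ha; pose proof (nodoid_sqrt_pos lam a th Hl Ha) as Hq.
set (f := fun x => sin x ^ 2 / sqrt (sin x ^ 2 + 4 * lam ^ 2 * a ^ 2) - sin x).
assert (Hf : forall x, continuous f x).
{ intros x; apply nodoid_height_integrand_continuous; auto. }
assert (D : is_derive (fun t => RInt f th0 t) th (f th)).
{ apply (is_derive_RInt f (fun t => RInt f th0 t) th0 th); [|apply Hf].
  apply filter_forall; intros y; apply (RInt_correct f th0 y).
  apply (ex_RInt_continuous f); intros; apply Hf. }
assert (E : forall J : R -> R, is_derive J th (f th) ->
              is_derive (fun t => z0 - 1 / (2 * lam) * J t) th
                (- (1 / (2 * lam) * f th))).
{ intros J HJ; auto_derive; [eexists; exact HJ|].
  rewrite (is_derive_unique (fun x : R => J x) _ _ HJ); ring. }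
evar_last; [exact (E _ D)|].
unfold f, nodoid_radius_of_curvature, fr1; field; lra.
Qed.

Lemma nodoid_angle_param (lam a : R) (z : R -> R) (b c : R) :
  lam < 0 -> 0 < a ->
  (forall th,
     is_derive z th (- (nodoid_radius_of_curvature lam a th * sin th))) ->
  angle_param (fr1 lam a) z (nodoid_radius_of_curvature lam a) b c.
Proof.
intros Hl Ha Hz th _.
pose proof (nodoid_sqrt_pos lam a th ltac:(lra) Ha) as Hq.
pose proof (nodoid_radicand_pos lam a th ltac:(lra) Ha) as Hq2.
split; [|split; [|split]].
- apply Rdiv_lt_0_compat; [apply fr1_pos|]; auto.
- apply (ex_derive_continuous (V := R_NormedModule)).
  unfold nodoid_radius_of_curvature, fr1.
  auto_derive; repeat split; simpl in *; lra.
- apply fr1_derive; auto; lra.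
- apply Hz.
Qed.

(** With [q = sin th - 2 * lam * r], the square root in the formula for the
    radius [r], the radius of curvature is [r / q], and the mean curvature
    [(sin th - q) / (2 * r)] is [lam]. *)
Lemma nodoid_mean_curvature (lam a th : R) :
  lam < 0 -> 0 < a ->
  (sin th / fr1 lam a th - / nodoid_radius_of_curvature lam a th) / 2 = lam.
Proof.
intros Hl Ha; pose proof (fr1_pos lam a th Hl Ha) as Hp.
pose proof (nodoid_sqrt_pos lam a th ltac:(lra) Ha) as Hq.
unfold nodoid_radius_of_curvature.
assert (E : sqrt (sin th ^ 2 + 4 * lam ^ 2 * a ^ 2)
            = sin th - 2 * lam * fr1 lam a th) by (unfold fr1; field; lra).
rewrite E in *; field; lra.
Qed.

Lemma fr2_eq_fr1 (lam th : R) : fr2 lam th = fr1 lam 1 th.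
Proof. unfold fr2, fr1; do 4 f_equal; ring. Qed.

Lemma fz1_derive (A rb lam al beta th : R) :
  lam <> 0 -> 0 < al ->
  is_derive (fz1 A rb lam al beta) th
    (- (nodoid_radius_of_curvature lam al th * sin th)).
Proof. intros; apply nodoid_height_derive; auto. Qed.

Lemma fz2_derive (A rb lam beta th : R) :
  lam <> 0 ->
  is_derive (fz2 A rb lam beta) th
    (- (nodoid_radius_of_curvature lam 1 th * sin th)).
Proof.
intros Hl.
eapply is_derive_ext;
  [|apply (nodoid_height_derive lam 1 (thbar2 A rb beta) (zbar A rb) th Hl Rlt_0_1)].
intros t; unfold fz2; do 2 f_equal.
apply RInt_ext; intros x _; do 4 f_equal; ring.
Qed.

Lemma fz1_start (A rb lam al beta : R) :
  fz1 A rb lam al beta (thbar1 A rb beta) = zbar A rb.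
Proof.
unfold fz1; rewrite RInt_point.
change (zbar A rb - 1 / (2 * lam) * 0 = zbar A rb); ring.
Qed.

Lemma fz2_start (A rb lam beta : R) :
  fz2 A rb lam beta (thbar2 A rb beta) = zbar A rb.
Proof.
unfold fz2; rewrite RInt_point.
change (zbar A rb - 1 / (2 * lam) * 0 = zbar A rb); ring.
Qed.

Lemma fr2_0 (lam : R) : lam <> 0 -> fr2 lam 0 = 1 <-> lam < 0.
Proof.
intros Hl; unfold fr2; rewrite sin_0.
replace (0 ^ 2 + 4 * lam ^ 2) with ((2 * lam) ^ 2) by ring.
rewrite <- Rsqr_pow2, sqrt_Rsqr_abs; split; intros H.
- apply Rnot_le_lt; intros K; rewrite Rabs_pos_eq in H by lra.
  replace ((0 - 2 * lam) / (2 * lam)) with (-1) in H by (field; lra); lra.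
- rewrite Rabs_left by lra; field; lra.
Qed.

(** Equal radii mean equal sines, so at a self-intersection both angles would be
    negative or both nonnegative; but [z] is strictly monotone on either of
    these half turns. *)
Lemma nodoid_injective (lam a : R) (z g : R -> R) (b c s t : R) :
  lam < 0 -> 0 < a -> angle_param (fr1 lam a) z g b c ->
  - PI < b -> c <= PI -> b <= s -> s < t -> t <= c ->
  fr1 lam a s = fr1 lam a t -> z s <> z t.
Proof.
intros Hl Ha H Hb Hc Hs Hst Ht Er Ez.
destruct (Rle_lt_dec t 0) as [K|K].
{ pose proof (z_increasing _ _ _ _ _ s t H Hs Hst Ht); lra. }
destruct (Rle_lt_dec 0 s) as [K'|K'].
{ pose proof (z_decreasing _ _ _ _ _ s t H Hs Hst Ht); lra. }
assert (sin s < 0) by (apply sin_lt_0_var; lra).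
assert (0 <= sin t) by (apply sin_ge_0; lra).
pose proof (fr1_antitone_sin lam a t s Hl Ha); lra.
Qed.

(** * The catenary *)

Lemma thbar3_spec (A rho : R) :
  0 < A -> A <= rho ->
  0 < thbar3 A rho <= PI / 2 /\
  rho * sin (thbar3 A rho) = A /\
  rho * cos (thbar3 A rho) = sqrt (rho ^ 2 - A ^ 2).
Proof.
intros HA Hr; unfold thbar3.
assert (Hq : 0 < A / rho <= 1).
{ split; [apply Rdiv_lt_0_compat; lra|].
  apply (Rmult_le_reg_r rho); [lra|]; unfold Rdiv.
  rewrite Rmult_assoc, Rinv_l; lra. }
pose proof (asin_bound (A / rho)) as [_ B].
assert (S : sin (asin (A / rho)) = A / rho) by (apply sin_asin; lra).
split; [split; [|exact B]|split].
- apply Rnot_le_lt; intros K.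
  pose proof (asin_bound (A / rho)); pose proof PI_RGT_0.
  destruct K as [K|K]; [|rewrite K, sin_0 in S; lra].
  apply sin_lt_0_var in K; lra.
- rewrite S; field; lra.
- rewrite cos_asin by lra.
  replace (rho ^ 2 - A ^ 2) with (rho ^ 2 * (1 - (A / rho)²))
    by (unfold Rsqr; field; lra).
  rewrite sqrt_mult_alt by apply pow2_ge_0.
  rewrite sqrt_pow2; lra.
Qed.

Lemma thbar3_antitone (A rho rho' : R) :
  0 < A -> A <= rho -> rho <= rho' -> thbar3 A rho' <= thbar3 A rho.
Proof.
intros HA H1 H2; apply Rnot_lt_le; intros K.
destruct (thbar3_spec A rho HA H1) as (B & S & _).
destruct (thbar3_spec A rho' HA ltac:(lra)) as (B' & S' & _).
assert (sin (thbar3 A rho) < sin (thbar3 A rho'))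
  by (apply sin_increasing_1; lra).
assert (0 < sin (thbar3 A rho)) by (apply sin_gt_0; lra).
nra.
Qed.

Lemma catenary_angle_param (A a : R) :
  0 < A -> 0 < a ->
  angle_param (fr3 A) (fz3 A) (fun th => A / sin th ^ 2) a (PI / 2).
Proof.
intros HA Ha th Hth.
assert (Hs : 0 < sin th) by (apply sin_gt_0; lra).
assert (Hc : 0 <= cos th) by (apply cos_ge_0; lra).
pose proof (sin2_cos2 th) as E; unfold Rsqr in E.
split; [|split; [|split]].
- apply Rdiv_lt_0_compat; nra.
- apply (ex_derive_continuous (V := R_NormedModule)).
  auto_derive; repeat split; nra.
- unfold fr3; auto_derive; [lra|field; lra].
- unfold fz3; auto_derive.
  + split; [lra|split; [apply Rdiv_lt_0_compat; lra|exact I]].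
  + apply (Rmult_eq_reg_r (sin th * (1 + cos th))); [|nra].
    transitivity (- A * (sin th * sin th + cos th * cos th + cos th));
      [field|rewrite E; field]; lra.
Qed.

Lemma catenary_point (A rho : R) :
  0 < A -> A <= rho ->
  fr3 A (thbar3 A rho) = rho /\ fz3 A (thbar3 A rho) = zbar A rho.
Proof.
intros HA Hr; destruct (thbar3_spec A rho HA Hr) as (B & S & C).
unfold fr3, fz3, zbar, arccosh; set (th := thbar3 A rho) in *.
assert (Hs : 0 < sin th) by (apply sin_gt_0; lra).
assert (Hc : 0 <= cos th) by (apply cos_ge_0; lra).
pose proof (sin2_cos2 th) as E; unfold Rsqr in E.
split; [rewrite <- S at 1; field; lra|].
do 2 f_equal.
replace (sqrt ((rho / A) ^ 2 - 1)) with (cos th / sin th).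
- rewrite <- S at 1; field; lra.
- replace ((rho / A) ^ 2 - 1) with ((cos th / sin th) ^ 2).
  + symmetry; apply sqrt_pow2, Rdiv_le_0_compat; lra.
  + rewrite <- S at 1.
    transitivity ((sin th * sin th + cos th * cos th) / sin th ^ 2 - 1);
      [field|rewrite E; field]; lra.
Qed.

Lemma catenary_foot (A : R) : fr3 A (PI / 2) = A /\ fz3 A (PI / 2) = 0.
Proof.
unfold fr3, fz3; rewrite sin_PI2, cos_PI2; split; [field|].
replace ((1 + 0) / 1) with 1 by field; rewrite ln_1; ring.
Qed.

Lemma catenary_arclength (A rho : R) :
  0 < A -> A <= rho ->
  arclength (fr3 A) (fz3 A) (thbar3 A rho) (PI / 2) = sqrt (rho ^ 2 - A ^ 2).
Proof.
intros HA Hr; destruct (thbar3_spec A rho HA Hr) as (B & S & C).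
pose proof (catenary_angle_param A (thbar3 A rho) HA ltac:(lra)) as P.
rewrite (arclength_angle_param _ _ _ _ _ (proj2 B) P), <- C.
set (th := thbar3 A rho) in *.
assert (Hs : 0 < sin th) by (apply sin_gt_0; lra).
rewrite (is_RInt_unique _ _ _ _
  (is_RInt_derive (fun x => - A * cos x / sin x) (fun x => A / sin x ^ 2)
     th (PI / 2)
     ltac:(rewrite Rmin_left, Rmax_right by lra; intros x Hx;
           assert (0 < sin x) by (apply sin_gt_0; lra);
           pose proof (sin2_cos2 x) as E; unfold Rsqr in E;
           auto_derive; [lra|];
           transitivity (A * (sin x * sin x + cos x * cos x) / sin x ^ 2);
           [field; lra|rewrite E; field; lra])
     ltac:(rewrite Rmin_left, Rmax_right by lra; intros x Hx; apply P, Hx))).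
rewrite sin_PI2, cos_PI2.
change (- A * 0 / 1 - - A * cos th / sin th = rho * cos th).
rewrite <- S at 2; field; lra.
Qed.

Lemma zbar_pos (A rho : R) : 0 < A -> A < rho -> 0 < zbar A rho.
Proof.
intros HA Hr; apply Rmult_lt_0_compat; [exact HA|].
assert (K : 1 < rho / A).
{ apply (Rmult_lt_reg_r A); [exact HA|]; unfold Rdiv.
  rewrite Rmult_assoc, Rinv_l; lra. }
unfold arccosh; rewrite <- ln_1; apply ln_increasing; [lra|].
pose proof (sqrt_pos ((rho / A) ^ 2 - 1)); lra.
Qed.

Lemma cosh_increasing (x y : R) : 0 <= x -> x < y -> cosh x < cosh y.
Proof.
intros Hx Hxy; unfold cosh; rewrite !exp_Ropp.
pose proof (exp_increasing _ _ Hxy) as H.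
assert (H1 : 1 <= exp x).
{ rewrite <- exp_0; destruct Hx as [Hx| <-]; [left; apply exp_increasing, Hx|lra]. }
set (u := exp x) in *; set (v := exp y) in *.
assert (E : (v + / v) - (u + / u) = (v - u) * (u * v - 1) / (u * v)) by (field; lra).
assert (0 < (v - u) * (u * v - 1) / (u * v)).
{ apply Rdiv_lt_0_compat; [apply Rmult_lt_0_compat|]; nra. }
lra.
Qed.

(** In cylindrical coordinates the catenary is the graph [r = A cosh (z / A)]. *)
Lemma cosh_zbar (A rho : R) :
  0 < A -> A <= rho -> 0 <= zbar A rho /\ A * cosh (zbar A rho / A) = rho.
Proof.
intros HA Hr; unfold zbar.
destruct (arccosh_spec (rho / A)) as [H1 H2].
{ apply (Rmult_le_reg_r A); [exact HA|]; unfold Rdiv.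
  rewrite Rmult_assoc, Rinv_l; lra. }
split; [nra|].
replace (A * arccosh (rho / A) / A) with (arccosh (rho / A)) by (field; lra).
rewrite H2; field; lra.
Qed.

Lemma catenary_graph (A rb rho z : R) :
  0 < A -> A <= rb -> rho <= rb -> 0 <= z -> rho = A * cosh (z / A) ->
  trace (fr3 A) (fz3 A) (thbar3 A rb) (PI / 2) (rho, z).
Proof.
intros HA Hrb Hrho Hz E.
assert (Hz' : 0 <= z / A) by (apply Rdiv_le_0_compat; lra).
assert (Hlow : A <= rho).
{ assert (1 <= cosh (z / A)).
  { replace 1 with (cosh 0) by (unfold cosh; rewrite Ropp_0, exp_0; field).
    destruct Hz' as [K|K]; [left; apply cosh_increasing; lra|rewrite <- K; lra]. }
  nra. }
destruct (catenary_point A rho HA Hlow) as [P1 P2].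
destruct (cosh_zbar A rho HA Hlow) as [Q1 Q2].
exists (thbar3 A rho); split; [split|].
- apply thbar3_antitone; auto.
- apply thbar3_spec; auto.
- rewrite P1, P2; f_equal.
  assert (Q0 : 0 <= zbar A rho / A) by (apply Rdiv_le_0_compat; lra).
  assert (Ec : cosh (zbar A rho / A) = cosh (z / A)) by nra.
  assert (Ez : zbar A rho / A = z / A).
  { destruct (Rtotal_order (zbar A rho / A) (z / A)) as [K|[K|K]]; auto;
      apply cosh_increasing in K; lra. }
  apply (f_equal (Rmult A)) in Ez.
  replace z with (A * (z / A)) by (field; lra).
  rewrite <- Ez; field; lra.
Qed.

(** * Closing up at the triple junction *)

Lemma junction_sines (A rb sigma beta : R) :
  rb * sin (thbar3 A rb) = A -> rb * cos (thbar3 A rb) = sigma ->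
  rb * sin (thbar1 A rb beta) = A * cos beta - sigma * sin beta /\
  rb * sin (thbar2 A rb beta) = - (A * cos beta + sigma * sin beta).
Proof.
unfold thbar1, thbar2; generalize (thbar3 A rb); intros th HA Hs; split.
- rewrite sin_minus, <- HA, <- Hs; ring.
- replace (th - PI + beta) with (th + beta - PI) by ring.
  rewrite sin_minus, cos_PI, sin_PI, sin_plus, <- HA, <- Hs; ring.
Qed.

(** The two equations on the left are the first integrals of the nodoids
    [fr1 lam 1] and [fr1 lam al] at the junction radius; they are linear in
    [lam] and [lam * al ^ 2]. *)
Lemma junction_equations (A sigma lam al beta : R) :
  sigma ^ 2 + A ^ 2 < 1 -> lam < 0 -> 0 < al ->
  (- (A * cos beta + sigma * sin beta) = lam * (sigma ^ 2 + A ^ 2 - 1) /\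
   A * cos beta - sigma * sin beta = lam * (sigma ^ 2 + A ^ 2 - al ^ 2))
  <->
  (lam = (A * cos beta + sigma * sin beta) / (1 - A ^ 2 - sigma ^ 2) /\
   al = sqrt (((2 * A ^ 2 + 2 * sigma ^ 2 - 1) * A * cos beta
                 + sigma * sin beta) / (A * cos beta + sigma * sin beta))).
Proof.
intros Hq Hl Ha.
set (c := cos beta); set (s := sin beta).
set (N := (2 * A ^ 2 + 2 * sigma ^ 2 - 1) * A * c + sigma * s).
assert (Hlam : - (A * c + sigma * s) = lam * (sigma ^ 2 + A ^ 2 - 1) <->
               lam = (A * c + sigma * s) / (1 - A ^ 2 - sigma ^ 2)).
{ split; intros H.
  - replace (A * c + sigma * s) with (lam * (1 - A ^ 2 - sigma ^ 2)) by lra.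
    field; lra.
  - rewrite H; field; lra. }
assert (Hal : - (A * c + sigma * s) = lam * (sigma ^ 2 + A ^ 2 - 1) ->
              A * c - sigma * s = lam * (sigma ^ 2 + A ^ 2 - al ^ 2) <->
              N / (A * c + sigma * s) = al ^ 2).
{ intros H.
  assert (HD : A * c + sigma * s = lam * (1 - A ^ 2 - sigma ^ 2)) by lra.
  assert (HD0 : A * c + sigma * s < 0) by (rewrite HD; nra).
  assert (EN : N - al ^ 2 * (A * c + sigma * s)
     = (1 - A ^ 2 - sigma ^ 2) *
       (lam * (sigma ^ 2 + A ^ 2 - al ^ 2) - (A * c - sigma * s))).
  { unfold N; transitivity
     ((sigma ^ 2 + A ^ 2 - al ^ 2) * (A * c + sigma * s)
        - (1 - A ^ 2 - sigma ^ 2) * (A * c - sigma * s)); [|rewrite HD]; ring. }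
  split; intros K.
  - rewrite K, Rminus_diag, Rmult_0_r in EN.
    replace N with (al ^ 2 * (A * c + sigma * s)) by lra; field; lra.
  - assert (K' : N = al ^ 2 * (A * c + sigma * s)) by (rewrite <- K; field; lra).
    rewrite K', Rminus_diag in EN.
    symmetry in EN; apply Rmult_integral in EN; lra. }
split; intros [H1 H2].
- split; [apply Hlam, H1|].
  apply Hal in H2; [|exact H1].
  rewrite H2; symmetry; apply sqrt_pow2; lra.
- apply Hlam in H1; split; [exact H1|].
  apply Hal; [exact H1|].
  rewrite H2; symmetry; apply pow2_sqrt.
  apply Rnot_lt_le; intros K; rewrite sqrt_neg_0 in H2 by lra; lra.
Qed.

(** * Relative position of the curves *)

(** The radius decreases with the sine, which is negative at [a] and nonnegative
    at [th]. *)
Lemma nodoid_inside (lam al a th : R) :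
  lam < 0 -> 0 < al -> - PI < a < 0 -> 0 <= th <= PI ->
  fr1 lam al th < fr1 lam al a.
Proof.
intros Hl Ha H Hth; apply fr1_antitone_sin; auto.
assert (sin a < 0) by (apply sin_lt_0_var; lra).
assert (0 <= sin th) by (apply sin_ge_0; lra); lra.
Qed.

(** The straight line through the junction in the direction [a2] separates the
    two curves: the second stays below it, since its angle decreases from [a2],
    and the first rises above it while its angle is nonpositive; at the other
    angles the first is inside the junction radius, unlike the second. *)
Lemma separated_by_tangent
    (r1 z1 g1 r2 z2 g2 : R -> R) (a1 c a2 s t : R) :
  angle_param r1 z1 g1 a1 c -> angle_param r2 z2 g2 0 a2 ->
  a2 - PI <= a1 -> 0 < a2 < PI / 2 ->
  r1 a1 = r2 a2 -> z1 a1 = z2 a2 ->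
  (forall th, 0 <= th <= c -> r1 th < r1 a1) ->
  a1 <= s <= c -> 0 <= t <= a2 ->
  r1 s = r2 t -> z1 s = z2 t -> s = a1.
Proof.
intros H1 H2 Ha1 Ha2 Er Ez Hin Hs Ht Ers Ezs.
destruct (Req_dec s a1) as [E|N]; [exact E|exfalso].
destruct (Rle_lt_dec 0 s) as [K|K].
- pose proof (Hin s ltac:(lra)) as Hlt.
  destruct (Req_dec t a2) as [->|Nt]; [lra|].
  pose proof (r_decreasing _ _ _ _ _ t a2 H2 ltac:(lra) ltac:(lra) ltac:(lra)
    ltac:(lra) ltac:(lra)); lra.
- pose proof (height_increasing _ _ _ _ _ a2 a1 s H1 ltac:(lra) ltac:(lra)
    ltac:(lra) ltac:(lra) ltac:(lra)) as K1.
  rewrite Ers, Ezs, Er, Ez in K1.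
  destruct (Req_dec t a2) as [->|Nt]; [lra|].
  pose proof (height_increasing _ _ _ _ _ a2 t a2 H2 ltac:(lra) ltac:(lra)
    ltac:(lra) ltac:(lra) ltac:(lra)); lra.
Qed.

(** If the nodoid came down outside the catenary, it would have to cross it:
    above the junction it is on the inner side of the graph
    [r = A cosh (z / A)], and the intermediate value theorem gives a crossing
    strictly inside the junction radius. *)
Lemma nodoid_foot_inside (A rb lam al thc a : R) (z : R -> R) :
  0 < A -> A < rb -> lam < 0 -> 0 < al -> - PI < a < 0 -> 0 < thc <= PI ->
  (forall th,
     is_derive z th (- (nodoid_radius_of_curvature lam al th * sin th))) ->
  fr1 lam al a = rb -> z a = zbar A rb -> z thc = 0 ->
  (forall p : R * R,
     trace (fr1 lam al) z a thc p ->
     trace (fr3 A) (fz3 A) (thbar3 A rb) (PI / 2) p -> p = (rb, zbar A rb)) ->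
  fr1 lam al thc < A.
Proof.
intros HA Hrb Hl Hal Ha Hthc Dz Hra Hza Hzc Hmeet.
apply Rnot_le_lt; intros Hle.
pose proof (nodoid_angle_param lam al z a thc Hl Hal Dz) as HP.
assert (Hz0 : zbar A rb < z 0).
{ rewrite <- Hza; apply (z_increasing _ _ _ _ _ _ _ HP); lra. }
destruct (cosh_zbar A rb HA ltac:(lra)) as [Zb0 Zb].
assert (Zb0' : 0 <= zbar A rb / A) by (apply Rdiv_le_0_compat; lra).
pose (h := fun th => fr1 lam al th - A * cosh (z th / A)).
assert (Hcont : continuity h).
{ intros th; apply continuity_pt_filterlim, (ex_derive_continuous h).
  pose proof (fr1_derive lam al th ltac:(lra) Hal) as D1.
  pose proof (Dz th) as D2; unfold h, cosh.
  generalize (fr1 lam al) D1; intros f Df.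
  auto_derive; repeat split; eexists; eassumption. }
assert (Hh0 : h 0 < 0).
{ unfold h.
  assert (cosh (zbar A rb / A) < cosh (z 0 / A)).
  { apply cosh_increasing; [exact Zb0'|].
    apply Rmult_lt_compat_r; [apply Rinv_0_lt_compat; lra|exact Hz0]. }
  pose proof (nodoid_inside lam al a 0 Hl Hal Ha ltac:(lra)); nra. }
assert (Hh1 : 0 <= h thc).
{ unfold h; rewrite Hzc.
  replace (0 / A) with 0 by (field; lra).
  unfold cosh; rewrite Ropp_0, exp_0; lra. }
destruct (IVT_gen h 0 thc 0 Hcont) as [th [Hth Hr]].
{ rewrite Rmin_left, Rmax_right; lra. }
rewrite Rmin_left, Rmax_right in Hth by lra.
pose proof (nodoid_inside lam al a th Hl Hal Ha ltac:(lra)) as Hin.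
assert (Hz : 0 <= z th).
{ destruct (Req_dec th thc) as [->|N]; [lra|].
  rewrite <- Hzc; left; apply (z_decreasing _ _ _ _ _ _ _ HP); lra. }
assert (E : (fr1 lam al th, z th) = (rb, zbar A rb)).
{ apply Hmeet.
  - exists th; split; [lra|reflexivity].
  - apply catenary_graph; try lra; unfold h in Hr; lra. }
injection E; intros; lra.
Qed.

(** The radius of the nodoid is largest where the sine is smallest: at the
    junction if its angle is at least [- PI / 2], else at [- PI / 2], where the
    bound [1] amounts to [lam * (1 - al ^ 2) < - 1]. *)
Lemma nodoid_in_cylinder (lam al a th : R) :
  lam < 0 -> 0 < al -> - PI < a < 0 -> fr1 lam al a < 1 ->
  (a < - (PI / 2) -> lam * (1 - al ^ 2) < -1) ->
  a <= th <= PI -> fr1 lam al th < 1.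
Proof.
intros Hl Hal Ha Hra Hmax Hth.
destruct (Rle_lt_dec 0 th) as [K|K].
{ pose proof (nodoid_inside lam al a th Hl Hal Ha ltac:(lra)); lra. }
destruct (Rlt_le_dec a (- (PI / 2))) as [Ka|Ka].
- apply fr1_lt; auto; [lra|].
  specialize (Hmax Ka); pose proof (SIN_bound th); lra.
- destruct (Req_dec th a) as [->|N]; [exact Hra|].
  apply Rlt_trans with (fr1 lam al a); [|exact Hra].
  apply fr1_antitone_sin; auto; apply sin_increasing_1; lra.
Qed.

Lemma sqrt_sum_sq (A sigma rb : R) :
  0 <= sigma -> 0 <= rb ->
  rb = sqrt (sigma ^ 2 + A ^ 2) <-> rb ^ 2 = sigma ^ 2 + A ^ 2.
Proof.
intros Hs Hr; split; intros H.
- rewrite H; apply pow2_sqrt.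
  pose proof (pow2_ge_0 sigma); pose proof (pow2_ge_0 A); lra.
- rewrite <- H; symmetry; apply sqrt_pow2, Hr.
Qed.

Lemma Omega0_sum_sq (A sigma : R) : Omega0 A sigma -> sigma ^ 2 + A ^ 2 < 1.
Proof.
intros [HA [Hs Hs']].
assert (E : sqrt (1 - A ^ 2) ^ 2 = 1 - A ^ 2) by (apply pow2_sqrt; nra).
nra.
Qed.

(** * Steady states satisfy the closing conditions *)

Lemma family_steady_state_necessary (beta thc A sigma rb lam al : R) :
  PI / 2 < beta < PI -> 0 < thc <= PI -> Omega0 A sigma ->
  A <= rb -> lam <> 0 -> 0 <= al ->
  family_steady_state A rb lam al beta thc ->
  arclength (fr3 A) (fz3 A) (thbar3 A rb) (PI / 2) = sigma ->
  cond_P A sigma rb lam al beta /\ cond_N A sigma rb lam al beta thc.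
Proof.
intros Hbeta Hthc HO Hrb Hlam Hal
  (B1 & B1' & B2 & B2' & B3 & G1 & G2 & G3 & R1 & R2 & R3 & SS) Hlen.
pose proof (Omega0_sum_sq A sigma HO) as Hq.
destruct HO as [HA [Hs _]].
destruct SS as (_ & _ & Hr13 & _ & _ & _ & Hbd & _).
destruct Hbd as (r1s & r3s & z2s & rb' & zb' & Hr1s & _ & _ & _ & _ & _ &
  E10 & E11 & E20 & E21 & _ & E31 & _ & _ & _ & _ & Hm13 & _).
destruct (thbar3_spec A rb ltac:(lra) Hrb) as (B30 & S3 & C3).
destruct (catenary_point A rb ltac:(lra) Hrb) as [P3r P3z].
rewrite (catenary_arclength A rb ltac:(lra) Hrb) in Hlen.
rewrite Hlen in C3.
assert (Hrb2 : rb ^ 2 = sigma ^ 2 + A ^ 2).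
{ rewrite <- Hlen, pow2_sqrt; [ring|nra]. }
assert (Hrbq : rb = sqrt (sigma ^ 2 + A ^ 2)) by (apply sqrt_sum_sq; lra).
assert (HArb : A < rb) by nra.
assert (Hrb1 : rb < 1) by nra.
assert (Hc : cos beta < 0) by (apply cos_lt_0; lra).
rewrite (reparam_start _ _ _ _ _ R1) in E10.
rewrite (reparam_end _ _ _ _ _ R1) in E11.
rewrite (reparam_start _ _ _ _ _ R2) in E20.
rewrite (reparam_end _ _ _ _ _ R2) in E21.
rewrite (reparam_end _ _ _ _ _ R3), P3r, P3z in E31.
injection E31; intros <- <-.
injection E11; intros _ E1.
injection E20; intros _ E2.
injection E21; intros _ E0.
injection E10; intros Ez Er0.
apply fr2_0 in E0; [|exact Hlam].
assert (Hal0 : 0 < al).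
{ destruct Hal as [K|K]; [exact K|exfalso].
  (* for [al = 0] the radius vanishes wherever the sine is nonnegative *)
  rewrite <- K in Er0; unfold fr1 in Er0.
  replace (sin thc ^ 2 + 4 * lam ^ 2 * 0 ^ 2) with (sin thc ^ 2) in Er0 by ring.
  rewrite sqrt_pow2 in Er0 by (apply sin_ge_0; lra).
  unfold Rdiv in Er0; rewrite Rminus_diag, Rmult_0_l in Er0; lra. }
rewrite fr2_eq_fr1 in E2.
apply fr1_first_integral in E1; [|lra|lra].
apply fr1_first_integral in E2; [|lra|lra].
destruct (junction_sines A rb sigma beta S3 C3) as [J1 J2].
rewrite J1, Hrb2 in E1; rewrite J2, Hrb2, pow1 in E2.
assert (Hdiff : lam * (1 - al ^ 2) = 2 * A * cos beta) by lra.
assert (Hal1 : al < 1).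
{ assert (0 < A * - cos beta) by (apply Rmult_lt_0_compat; lra).
  apply Rnot_le_lt; intros K; assert (1 - al ^ 2 <= 0) by nra; nra. }
destruct (proj1 (junction_equations A sigma lam al beta Hq E0 Hal0)
  (conj E2 E1)) as [Elam Eal].
split.
- unfold cond_P; rewrite <- Hrbq; unfold thbar1, thbar2 in *.
  repeat split; auto; try lra; apply zbar_pos; lra.
- split; [|split; [|split]].
  + assert (K : A * (2 * A ^ 2 + 2 * sigma ^ 2 - 1) * cos beta
                + sigma * sin beta < 0).
    { assert (X : A * (2 * A ^ 2 + 2 * sigma ^ 2 - 1) * cos beta
                + sigma * sin beta
                = lam * al ^ 2 * (1 - sigma ^ 2 - A ^ 2)).
      { transitivity
         ((sigma ^ 2 + A ^ 2) * (A * cos beta + sigma * sin beta)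
          - (1 - sigma ^ 2 - A ^ 2) * (A * cos beta - sigma * sin beta)); [ring|].
        rewrite E1.
        replace (A * cos beta + sigma * sin beta)
          with (lam * (1 - sigma ^ 2 - A ^ 2)) by lra; ring. }
      rewrite X; assert (0 < al ^ 2) by nra.
      assert (lam * al ^ 2 < 0) by nra; nra. }
    apply Rlt_gt, Rlt_0_minus.
    replace (tan beta - A / sigma * (1 - 2 * A ^ 2 - 2 * sigma ^ 2))
      with ((- (A * (2 * A ^ 2 + 2 * sigma ^ 2 - 1) * cos beta
                + sigma * sin beta)) / (sigma * - cos beta))
      by (unfold tan; field; lra).
    apply Rdiv_lt_0_compat; nra.
  + rewrite <- Hrbq; intros Hlt.
    (* then the bulge [th = - PI / 2] of the nodoid belongs to the curve *)
    assert (Hang : thbar1 A rb beta < - (PI / 2)).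
    { assert (K : thbar3 A rb + PI / 2 < beta).
      { apply cos_decreasing_0; try lra.
        replace (cos (thbar3 A rb + PI / 2)) with (- sin (thbar3 A rb))
          by (rewrite cos_plus, cos_PI2, sin_PI2; ring).
        replace (sin (thbar3 A rb)) with (A / rb); [exact Hlt|].
        rewrite <- S3 at 1; field; lra. }
      unfold thbar1; lra. }
    destruct (reparam_onto _ _ _ _ _ (- (PI / 2)) R1 ltac:(lra)) as [t [Ht Et]].
    destruct (Hr13 t Ht) as [[_ Hlt1] _].
    injection Et; intros _ Er; rewrite Er in Hlt1.
    apply fr1_lt in Hlt1; [|lra|lra|lra].
    rewrite sin_neg, sin_PI2 in Hlt1.
    apply (Rmult_lt_reg_l (2 * A)); [lra|].
    replace (2 * A * - (1 / (2 * A))) with (-1) by (field; lra); lra.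
  + exact Ez.
  + intros p; split.
    * intros [[s [Hs1 Es]] [t [Ht1 Et]]].
      destruct (reparam_onto _ _ _ _ _ s R1 Hs1) as [s' [Hs' Es']].
      destruct (reparam_onto _ _ _ _ _ t R3 Ht1) as [t' [Ht' Et']].
      rewrite Es, <- Es'; apply (Hm13 s' t' Hs' Ht'); congruence.
    * intros ->; split.
      -- exists (thbar1 A rb beta); split; [lra|]; symmetry; exact E11.
      -- exists (thbar3 A rb); split; [lra|]; congruence.
Qed.

(** * The closing conditions produce a steady state *)

Lemma closing_conditions_sufficient (beta thc A sigma rb lam al : R) :
  PI / 2 < beta < PI -> 0 < thc <= PI -> Omega0 A sigma -> A <= rb ->
  cond_P A sigma rb lam al beta -> cond_N A sigma rb lam al beta thc ->
  family_steady_state A rb lam al beta thc /\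
  arclength (fr3 A) (fz3 A) (thbar3 A rb) (PI / 2) = sigma.
Proof.
intros Hbeta Hthc HO Hrb
  (Hrbq & Hrb1 & _ & Hzb & _ & _ & _ & B3 & B1 & B2 & Elam & Hlam & Eal & Hal)
  (_ & N2 & Nz & Nmeet).
pose proof (Omega0_sum_sq A sigma HO) as Hq.
destruct HO as [HA [Hs _]].
destruct (thbar3_spec A rb ltac:(lra) Hrb) as (_ & S3 & C3).
destruct (catenary_point A rb ltac:(lra) Hrb) as [P3r P3z].
destruct (catenary_foot A) as [F3r F3z].
assert (Hrb2 : rb ^ 2 = sigma ^ 2 + A ^ 2) by (apply sqrt_sum_sq; lra).
assert (Hsig : sqrt (rb ^ 2 - A ^ 2) = sigma).
{ replace (rb ^ 2 - A ^ 2) with (sigma ^ 2) by lra; apply sqrt_pow2; lra. }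
split; [|rewrite catenary_arclength by lra; exact Hsig].
rewrite Hsig in C3.
assert (HArb : A < rb) by nra.
destruct (proj2 (junction_equations A sigma lam al beta Hq Hlam (proj1 Hal))
  (conj Elam Eal)) as [E2 E1].
assert (Hdiff : lam * (1 - al ^ 2) = 2 * A * cos beta) by lra.
destruct (junction_sines A rb sigma beta S3 C3) as [J1 J2].
rewrite <- J2, <- Hrb2 in E2; rewrite <- J1, <- Hrb2 in E1.
replace (rb ^ 2 - 1) with (rb ^ 2 - 1 ^ 2) in E2 by ring.
apply fr1_first_integral in E1; [|lra|lra].
apply fr1_first_integral in E2; [|lra|lra].
assert (E0 : fr2 lam 0 = 1) by (apply fr2_0; lra).
pose proof (fz1_start A rb lam al beta) as Z1.
pose proof (fz2_start A rb lam beta) as Z2.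
set (g1 := nodoid_radius_of_curvature lam al).
set (g2 := nodoid_radius_of_curvature lam 1).
set (g3 := fun th => A / sin th ^ 2).
set (z1 := fz1 A rb lam al beta) in *.
set (z2 := fz2 A rb lam beta) in *.
assert (P1 : angle_param (fr1 lam al) z1 g1 (thbar1 A rb beta) thc).
{ apply nodoid_angle_param; [lra|lra|].
  intros; apply fz1_derive; lra. }
assert (P2 : angle_param (fr1 lam 1) z2 g2 0 (thbar2 A rb beta)).
{ apply nodoid_angle_param; [lra|lra|].
  intros; apply fz2_derive; lra. }
assert (P2' : angle_param (fr2 lam) z2 g2 0 (thbar2 A rb beta)).
{ intros th Hth; destruct (P2 th Hth) as (K1 & K2 & K3 & K4).
  split; [exact K1|split; [exact K2|split; [|exact K4]]].
  apply (is_derive_ext (fr1 lam 1)); [|exact K3].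
  intros; symmetry; apply fr2_eq_fr1. }
pose proof (catenary_angle_param A (thbar3 A rb) (proj1 HA) (proj1 B3)) as P3.
change (angle_param (fr3 A) (fz3 A) g3 (thbar3 A rb) (PI / 2)) in P3.
rewrite <- fr2_eq_fr1 in E2.
assert (Hpos1 : forall th, 0 < fr1 lam al th) by (intros; apply fr1_pos; lra).
assert (Hpos2 : forall th, 0 < fr2 lam th)
  by (intros; rewrite fr2_eq_fr1; apply fr1_pos; lra).
assert (Hpos3 : forall th, thbar3 A rb <= th <= PI / 2 -> 0 < fr3 A th).
{ intros th Hth; apply Rdiv_lt_0_compat; [lra|apply sin_gt_0; lra]. }
assert (Hup1 : forall th, thbar1 A rb beta <= th <= thc -> fr1 lam al th < 1).
{ intros th Hth; apply (nodoid_in_cylinder lam al (thbar1 A rb beta)); try lra.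
  intros K; rewrite Hdiff.
  assert (Hc : cos beta < - (A / rb)).
  { replace (A / rb) with (sin (thbar3 A rb)) by (rewrite <- S3 at 2; field; lra).
    replace (- sin (thbar3 A rb)) with (cos (thbar3 A rb + PI / 2))
      by (rewrite cos_plus, cos_PI2, sin_PI2; ring).
    unfold thbar1 in K; apply cos_decreasing_1; lra. }
  rewrite <- Hrbq in N2; apply N2 in Hc.
  apply (Rmult_lt_compat_l (2 * A)) in Hc; [|lra].
  replace (2 * A * - (1 / (2 * A))) with (-1) in Hc by (field; lra); lra. }
assert (Hlow2 : forall th, 0 <= th <= thbar2 A rb beta ->
                  th = thbar2 A rb beta \/ rb < fr2 lam th).
{ intros th Hth; destruct (Req_dec th (thbar2 A rb beta)) as [E|N]; [auto|right].
  rewrite <- E2; apply (r_decreasing _ _ _ _ _ _ _ P2'); lra. }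
assert (Hup2 : forall th, 0 < th <= thbar2 A rb beta -> fr2 lam th < 1).
{ intros th Hth; rewrite <- E0; apply (r_decreasing _ _ _ _ _ _ _ P2'); lra. }
assert (Hup3 : forall th, thbar3 A rb <= th <= PI / 2 ->
                 th = thbar3 A rb \/ fr3 A th < rb).
{ intros th Hth; destruct (Req_dec th (thbar3 A rb)) as [E|N]; [auto|right].
  rewrite <- P3r; apply (r_decreasing _ _ _ _ _ _ _ P3); lra. }
assert (Hz1 : forall th, thbar1 A rb beta <= th < thc -> 0 < z1 th).
{ intros th Hth; destruct (Rle_lt_dec 0 th) as [K|K].
  - rewrite <- Nz; apply (z_decreasing _ _ _ _ _ _ _ P1); lra.
  - destruct (Req_dec th (thbar1 A rb beta)) as [->|N]; [lra|].
    pose proof (z_increasing _ _ _ _ _ (thbar1 A rb beta) th P1); lra. }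
assert (Hz2 : forall th, 0 <= th <= thbar2 A rb beta -> 0 < z2 th).
{ intros th Hth; destruct (Req_dec th (thbar2 A rb beta)) as [->|N]; [lra|].
  pose proof (z_decreasing _ _ _ _ _ th (thbar2 A rb beta) P2'); lra. }
assert (Hz3 : forall th, thbar3 A rb <= th < PI / 2 -> 0 < fz3 A th).
{ intros th Hth; rewrite <- F3z; apply (z_decreasing _ _ _ _ _ _ _ P3); lra. }
assert (Hfoot : fr1 lam al thc < A).
{ apply (nodoid_foot_inside A rb lam al thc (thbar1 A rb beta) z1);
    auto; try lra.
  - intros th; apply fz1_derive; lra.
  - intros p K1 K2; apply Nmeet; auto. }
destruct (arclength_reparam_exists (fr1 lam al) z1 g1 (thbar1 A rb beta) thc)
  as (G1 & t1 & R1 & T10 & T11 & D1 & V1 & K1 & A1); auto; [lra|].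
destruct (arclength_reparam_exists (fr2 lam) z2 g2 0 (thbar2 A rb beta))
  as (G2 & t2 & R2 & T20 & T21 & D2 & V2 & K2 & A2); auto; [lra|].
destruct (arclength_reparam_exists (fr3 A) (fz3 A) g3 (thbar3 A rb) (PI / 2))
  as (G3 & t3 & R3 & T30 & T31 & D3 & V3 & K3 & A3); auto; [lra|].
do 3 (split; [lra|]); split; [lra|split; [lra|]].
exists G1, G2, G3; split; [exact R1|split; [exact R2|split; [exact R3|]]].
split; [lra|split; [lra|]].
split; [|split; [|split; [|split; [|split; [|split; [exact K1|split; [exact K2|
  split; [exact K3|split]]]]]]]].
- intros t Ht.
  destruct (V1 t Ht) as (I1 & -> & _); destruct (V3 t Ht) as (I3 & -> & _).
  split; split; auto.
  destruct (Hup3 _ I3) as [->|K]; [rewrite P3r|]; lra.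
- intros t Ht.
  assert (Ht' : unit_itv t) by (unfold unit_itv; lra).
  destruct (V2 t Ht') as (I2 & -> & _).
  split; [auto|apply Hup2; split; [|apply I2]].
  rewrite <- T21; apply D2, Ht.
- intros t Ht.
  assert (Ht' : unit_itv t) by (unfold unit_itv; lra).
  destruct (V1 t Ht') as (I1 & _ & -> & _); destruct (V3 t Ht') as (I3 & _ & -> & _).
  pose proof (D1 0 t (proj1 Ht)); pose proof (D3 0 t (proj1 Ht)).
  split; [apply Hz1|apply Hz3]; lra.
- intros t Ht; destruct (V2 t Ht) as (I2 & _ & -> & _); auto.
- exists (fr1 lam al thc), A, (z2 0), rb, (zbar A rb).
  rewrite (reparam_start _ _ _ _ _ R1), (reparam_end _ _ _ _ _ R1).
  rewrite (reparam_start _ _ _ _ _ R2), (reparam_end _ _ _ _ _ R2).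
  rewrite (reparam_start _ _ _ _ _ R3), (reparam_end _ _ _ _ _ R3).
  rewrite Nz, E1, E2, E0, Z1, Z2, F3r, F3z, P3r, P3z.
  repeat (split; [solve [reflexivity|auto|apply Hz2; lra|lra]|]).
  split; [|split; [|split; [|split; [|split]]]].
  + apply (simple_of_angle_injective G1 t1 (fr1 lam al) z1 (thbar1 A rb beta) thc); auto.
    { intros t Ht; destruct (V1 t Ht) as (? & ? & ? & _); auto. }
    intros th th' Ha Hlt Hb.
    apply (nodoid_injective lam al z1 g1 (thbar1 A rb beta) thc); lra || auto.
  + apply (simple_of_angle_injective G2 t2 (fr2 lam) z2 0 (thbar2 A rb beta)); auto.
    { intros t Ht; destruct (V2 t Ht) as (? & ? & ? & _); auto. }
    intros th th' Ha Hlt Hb Er.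
    pose proof (r_decreasing _ _ _ _ _ th th' P2'); lra.
  + apply (simple_of_angle_injective G3 t3 (fr3 A) (fz3 A) (thbar3 A rb) (PI / 2)); auto.
    { intros t Ht; destruct (V3 t Ht) as (? & ? & ? & _); auto. }
    intros th th' Ha Hlt Hb Er.
    pose proof (r_decreasing _ _ _ _ _ th th' P3); lra.
  + intros s t Hs' Ht E; injection E; intros Ez Er.
    destruct (V1 s Hs') as (I1 & Rs & Zs & _).
    destruct (V2 t Ht) as (I2 & Rt & Zt & _).
    unfold pt; rewrite Rs, Zs.
    replace (t1 s) with (thbar1 A rb beta); [congruence|].
    symmetry; apply (separated_by_tangent (fr1 lam al) z1 g1 (fr2 lam) z2 g2
      (thbar1 A rb beta) thc (thbar2 A rb beta) (t1 s) (t2 t)); auto;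
      try congruence; try (unfold thbar1, thbar2 in *; lra).
    intros th Hth; apply nodoid_inside; lra.
  + intros s t Hs' Ht E; apply Nmeet; split.
    * destruct (V1 s Hs') as (I1 & Rs & Zs & _).
      exists (t1 s); split; [exact I1|unfold pt; congruence].
    * rewrite E; destruct (V3 t Ht) as (I3 & Rt & Zt & _).
      exists (t3 t); split; [exact I3|unfold pt; congruence].
  + intros s t Hs' Ht E; injection E; intros _ Er.
    destruct (V2 s Hs') as (I2 & Rs & Zs & _).
    destruct (V3 t Ht) as (I3 & Rt & _).
    unfold pt; rewrite Rs, Zs; rewrite Rs, Rt in Er.
    destruct (Hlow2 _ I2) as [->|L2]; [congruence|].
    destruct (Hup3 _ I3) as [E3|L3]; [rewrite E3, P3r in Er|]; lra.
- exists lam; intros t Ht.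
  destruct (V1 t Ht) as (_ & _ & _ & ->).
  destruct (V2 t Ht) as (_ & _ & _ & ->).
  destruct (V3 t Ht) as (I3 & _ & _ & ->).
  split; [apply nodoid_mean_curvature; lra|split].
  + rewrite fr2_eq_fr1; apply nodoid_mean_curvature; lra.
  + assert (0 < sin (t3 t)) by (apply sin_gt_0; lra).
    unfold fr3, g3; field; lra.
- pose proof PI_RGT_0.
  exists t1, t2, t3.
  split; [apply A1; lra|split; [apply A2; lra|split; [apply A3; lra|]]].
  rewrite T10, T11, T20, T21, T30, T31.
  unfold thbar1, thbar2; repeat split; lra.
Qed.

Theorem theorem4p14 (beta thc A sigma rb lam al : R)
  (hbeta : PI / 2 < beta < PI) (hthc : 0 < thc <= PI)
  (hOmega : Omega0 A sigma)
  (hrb : A <= rb) (hlam : lam <> 0) (hal : 0 <= al) :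
  (family_steady_state A rb lam al beta thc /\
   arclength (fr3 A) (fz3 A) (thbar3 A rb) (PI / 2) = sigma)
  <->
  (cond_P A sigma rb lam al beta /\ cond_N A sigma rb lam al beta thc).
Proof.
split.
- intros [H1 H2]; apply family_steady_state_necessary; auto.
- intros [H1 H2]; apply closing_conditions_sufficient; auto.
Qed.
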